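(* Let $K$ be a field. Then there exists a finitely generated non-PI prime $\mathbb{N}$-graded (unital, associative) $K$-algebra of GK dimension two whose extended centre has infinite transcendence degree over $K$.
   Context: All algebras are associative with identity; ideals are two-sided. An algebra is non-PI if it satisfies no nontrivial polynomial identity. A $K$-algebra $A$ is $\mathbb{N}$-graded if $A=\bigoplus_{n\ge 0}A_n$ as $K$-vector spaces with $A_iA_j\subseteq A_{i+j}$. GK dimension: for a $K$-subspace $V$ of $A$, $V^n$ denotes the $K$-span of all products of $n$ elements of $V$. A frame for $A$ is a finite-dimensional $K$-subspace $V$ with $1\in V$ that generates $A$ as a $K$-algebra. For finitely generated $A$ with frame $V$, $$\operatorname{GKdim}(A)=\limsup_{n\to\infty}\frac{\log(\dim_K V^n)}{\log n},$$ which does not depend on the choice of $V$. Extended centre: for a prime algebra $A$, the Martindale ring of quotients is the set of equivalence classes of pairs $(I,f)$, where $I$ is a nonzero ideal of $A$ and $f:I\to A$ is a homomorphism of right $A$-modules, with $(I,f)\sim(J,g)$ if $f$ and $g$ agree on some nonzero ideal contained in $I\cap J$; addition is pointwise on $I\cap J$, and the product of the classes of $(I,f)$ and $(J,g)$ is the class of $(JI, f\circ g)$. It contains $A$ via left multiplications. The extended centre of $A$ is the centre of this ring; it is a field containing $K$. *)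

(* Defs.v *)
From HB Require Import structures.
From mathcomp Require Import all_boot all_order all_algebra.
From mathcomp Require Import all_classical all_reals all_analysis.
(* Only partly imported: the notations of multinomials clash with those of
   mathcomp-analysis. *)
From mathcomp Require mpoly monalg.
Import (canonicals, coercions) monalg mpoly.

Set Implicit Arguments.
Unset Strict Implicit.
Unset Printing Implicit Defensive.

Import Order.TTheory GRing.Theory Num.Theory.
Local Open Scope classical_set_scope.
Local Open Scope quotient_scope.
Local Open Scope ring_scope.

Section Algebras.
Context {K : fieldType} {A : algType K}.

Definition kspan (S : set A) : set A :=
  smallest (fun U => GRing.submod_closed [in U]) S.

Definition generated_subalgebra (S : set A) : set A :=
  smallest (fun B => GRing.subalg_closed [in B]) S.

Definition grading (g : nat -> set A) : Prop :=
  [/\ forall n, GRing.submod_closed [in g n],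
      forall i j x y, g i x -> g j y -> g (i + j)%N (x * y),
      forall x, exists n (f : nat -> A),
        (forall i, g i (f i)) /\ x = \sum_(i < n) f i
    & forall n (f : nat -> A), (forall i, g i (f i)) ->
        \sum_(i < n) f i = 0 -> forall i, (i < n)%N -> f i = 0].

(* A word in the free monoid on nat is a noncommutative monomial in the
   indeterminates X_0, X_1, ..., so malg is the free algebra on them. *)
Definition polynomial_identity
    (p : monalg.malg (monalg.fmonom nat) K) : Prop :=
  forall a : nat -> A,
    monalg.mmap (in_alg A) (fun m : monalg.fmonom nat => \prod_(i <- m) a i) p
    = 0.

Definition lin_indep (s : seq A) : Prop :=
  forall c : 'I_(size s) -> K,
    \sum_(i < size s) c i *: s`_i = 0 -> forall i, c i = 0.

Definition is_basis (U : set A) (s : seq A) : Prop :=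
  lin_indep s /\ kspan [set` s] = U.

(* The dimension of a finite-dimensional subspace U (0 when U is not one). *)
Definition kdim (U : set A) : nat := size (xget [::] [set s | is_basis U s]).

Definition subspace_pow (V : set A) (n : nat) : set A :=
  kspan [set x | exists2 v : 'I_n -> A,
    (forall i, V (v i)) & x = \prod_(i < n) v i].

Definition frame (V : set A) : Prop :=
  [/\ exists s : seq A, V = kspan [set` s], V 1
    & generated_subalgebra V = setT].

Definition ideal (I : set A) : Prop :=
  [/\ I 0, forall x y, I x -> I y -> I (x + y)
    & forall a x, I x -> I (a * x) /\ I (x * a)].

Definition nonzero_ideal (I : set A) : Prop :=
  ideal I /\ exists2 x, I x & x != 0.

Definition ideal_mul (I J : set A) : set A :=
  [set x | exists n (u v : 'I_n -> A),
    (forall i, I (u i) /\ J (v i)) /\ x = \sum_(i < n) u i * v i].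

(* Right A-module homomorphism I -> A; f is total, and its values outside I
   are immaterial. *)
Definition right_hom (I : set A) (f : A -> A) : Prop :=
  (forall x y, I x -> I y -> f (x + y) = f x + f y) /\
  (forall x a, I x -> f (x * a) = f x * a).

End Algebras.

Definition finitely_generated (K : fieldType) (A : algType K) : Prop :=
  exists s : seq A, generated_subalgebra [set` s] = setT.

Definition PI_algebra (K : fieldType) (A : algType K) : Prop :=
  exists2 p, p != 0 & polynomial_identity (A := A) p.

(* The zero algebra is already excluded by algType. *)
Definition prime_algebra (K : fieldType) (A : algType K) : Prop :=
  forall I J : set A, ideal I -> ideal J ->
    ideal_mul I J = [set 0] -> I = [set 0] \/ J = [set 0].

(* The value does not depend on the frame. The terms n = 0, 1, where ln n = 0,
   are immaterial to the limit superior. *)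
Definition has_GKdim (R : realType) (K : fieldType) (A : algType K)
    (d : \bar R) : Prop :=
  exists2 V : set A, frame V &
    limn_esup (fun n => (ln (kdim (subspace_pow V n))%:R / ln n%:R)%:E) = d.

Section Ideals.
Context {K : fieldType} {A : algType K}.
Implicit Types (I J : set A).

Lemma ideal_mulP I J x y : I x -> J y -> ideal_mul I J (x * y).
Proof.
move=> Ix Jy; exists 1%N, (fun=> x), (fun=> y); split=> //.
by rewrite big_ord1.
Qed.

Lemma ideal_mul_min I J (P : set A) : P 0 ->
  (forall x y, P x -> P y -> P (x + y)) ->
  (forall x y, I x -> J y -> P (x * y)) -> ideal_mul I J `<=` P.
Proof.
move=> P0 PD PM _ [n [u [v [uv ->]]]].
by elim/big_ind: _ => // i _; have [] := uv i; apply: PM.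
Qed.

Lemma ideal_mul0 I J : ideal_mul I J 0.
Proof.
by exists 0%N, (fun=> 0), (fun=> 0); split=> [[]//|]; rewrite big_ord0.
Qed.

Lemma ideal_mulD I J x y :
  ideal_mul I J x -> ideal_mul I J y -> ideal_mul I J (x + y).
Proof.
move=> [n [u [v [uv ->]]]] [m [u' [v' [uv' ->]]]].
pose w T (a : 'I_n -> T) (b : 'I_m -> T) (i : 'I_(n + m)) :=
  match fintype.split i with inl j => a j | inr j => b j end.
exists (n + m)%N, (w A u u'), (w A v v'); split.
  by move=> i; rewrite /w; case: (fintype.split i).
rewrite big_split_ord /=; congr (_ + _); apply: eq_bigr => i _.
  by rewrite /w -[lshift _ _]/(unsplit (inl i)) unsplitK.
by rewrite /w -[rshift _ _]/(unsplit (inr i)) unsplitK.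
Qed.

Lemma ideal_ideal_mul I J : ideal I -> ideal J -> ideal (ideal_mul I J).
Proof.
move=> [I0 ID IM] [J0 JD JM]; split.
- exact: ideal_mul0.
- exact: ideal_mulD.
move=> a x Hx; split; move: x Hx; apply: ideal_mul_min.
- by rewrite mulr0; apply: ideal_mul0.
- by move=> x y; rewrite mulrDr; apply: ideal_mulD.
- by move=> x y Ix Jy; rewrite mulrA; apply: ideal_mulP=> //; case: (IM a x Ix).
- by rewrite mul0r; apply: ideal_mul0.
- by move=> x y; rewrite mulrDl; apply: ideal_mulD.
- by move=> x y Ix Jy; rewrite -mulrA; apply: ideal_mulP=> //; case: (JM a y Jy).
Qed.

Lemma ideal_mul_subr I J : ideal J -> ideal_mul I J `<=` J.
Proof. by move=> [J0 JD JM]; apply: ideal_mul_min=> // x y _ /JM-/(_ x)[]. Qed.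

Lemma ideal_mul_subl I J : ideal I -> ideal_mul I J `<=` I.
Proof. by move=> [J0 JD JM]; apply: ideal_mul_min=> // x y /JM-/(_ y)[]. Qed.

Lemma nonzero_idealT : nonzero_ideal [set: A].
Proof. by split=> //; exists 1 => //; apply: oner_neq0. Qed.

Lemma nonzero_ideal_mul I J : prime_algebra A ->
  nonzero_ideal I -> nonzero_ideal J -> nonzero_ideal (ideal_mul I J).
Proof.
move=> primeA [II [x Ix x0]] [IJ [y Jy y0]].
have IIJ := ideal_ideal_mul II IJ; split=> //.
apply: contrapT => H.
have /(primeA I J II IJ) [E|E] : ideal_mul I J = [set 0].
- rewrite eqEsubset; split=> [z Hz|z ->]; last by case: IIJ.
  by apply: contrapT => /eqP z0; apply: H; exists z.
- by move: Ix x0; rewrite E => ->; rewrite eqxx.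
- by move: Jy y0; rewrite E => ->; rewrite eqxx.
Qed.

Lemma nonzero_idealI I J : prime_algebra A ->
  nonzero_ideal I -> nonzero_ideal J -> nonzero_ideal (I `&` J).
Proof.
move=> primeA HI HJ; have [_ [x Hx x0]] := nonzero_ideal_mul primeA HI HJ.
have [[I0 ID IM] [J0 JD JM]] := (HI.1, HJ.1); split.
  split=> //= [y z [? ?] [? ?]|a y [Iy Jy]]; first by split; auto.
  by have [? ?] := IM a y Iy; have [? ?] := JM a y Jy.
by exists x => //; split; [apply: ideal_mul_subl Hx|apply: ideal_mul_subr Hx];
  case: HI HJ => [? _] [? _].
Qed.

Lemma ideal_mulS I I' J J' : I `<=` I' -> J `<=` J' ->
  ideal_mul I J `<=` ideal_mul I' J'.
Proof.
move=> sI sJ x [n [u [v [uv ->]]]]; exists n, u, v; split=> // i.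
by have [? ?] := uv i; split; auto.
Qed.

Lemma right_hom0 I f : ideal I -> right_hom I f -> f 0 = 0.
Proof. by move=> [I0 _ _] [_ fM]; rewrite -{1}(mulr0 0) fM// mulr0. Qed.

Lemma right_homS I J f : J `<=` I -> right_hom I f -> right_hom J f.
Proof.
by move=> JI [fD fM]; split=> [x y /JI Ix /JI Iy|x a /JI Ix]; auto.
Qed.

Lemma right_homD I J f g : right_hom I f -> right_hom J g ->
  right_hom (I `&` J) (fun x => f x + g x).
Proof.
move=> [fD fM] [gD gM]; split=> [x y [Ix Jx] [Iy Jy]|x a [Ix Jx]].
  by rewrite fD// gD// addrACA.
by rewrite fM// gM// mulrDl.
Qed.

Lemma right_homZ I f (k : K) : right_hom I f -> right_hom I (fun x => k *: f x).
Proof.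
move=> [fD fM]; split=> [x y Ix Iy|x a Ix]; first by rewrite fD// scalerDr.
by rewrite fM// scalerAl.
Qed.

Lemma right_hom_scale (k : K) : right_hom [set: A] ( *:%R k).
Proof. by split=> [x y _ _|x a _]; rewrite ?scalerDr ?scalerAl. Qed.

Lemma right_hom_comp I J f g : ideal I -> ideal J ->
  right_hom I f -> right_hom J g -> right_hom (ideal_mul J I) (f \o g) /\
  forall x, ideal_mul J I x -> I (g x).
Proof.
move=> II IJ [fD fM] [gD gM].
have sI : forall x, ideal_mul J I x -> I (g x).
  suff H : ideal_mul J I `<=` J `&` [set x | I (g x)] by move=> x /H[].
  apply: ideal_mul_min.
  - split=> /=; first by case: IJ.
    by rewrite (right_hom0 IJ)//; case: II.
  - move=> x y [Jx Ix] [Jy Iy]; split=> /=; first by case: IJ => _ + _; apply.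
    by rewrite gD//; case: II => _ + _; apply.
  - move=> x y Jx Iy; split=> /=; first by case: IJ => _ _ /(_ y x Jx)[].
    by rewrite gM//; case: II => _ _ /(_ (g x) y Iy)[].
split=> //; have sJ := ideal_mul_subl IJ; split=> [x y Hx Hy|x a Hx] /=.
  by rewrite gD ?fD//; first [exact: sI|exact: (sJ I)].
by rewrite gM ?fM//; first [exact: sI|exact: (sJ I)].
Qed.

End Ideals.

Section Martindale.
Context (K : fieldType) (A : algType K).

Record qpair := QPair {
  qdom : set A;
  qfun : A -> A;
  qdomP : nonzero_ideal qdom;
  qfunP : right_hom qdom qfun }.

HB.instance Definition _ := gen_eqMixin qpair.
HB.instance Definition _ := gen_choiceMixin qpair.

Definition qequiv_prop (p q : qpair) : Prop :=
  exists L : set A, [/\ nonzero_ideal L, L `<=` qdom p `&` qdom q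
    & forall x, L x -> qfun p x = qfun q x].

Context (primeA : prime_algebra A).

Definition qequiv_rel : rel qpair := fun p q => `[< qequiv_prop p q >].

Lemma qequiv_refl : reflexive qequiv_rel.
Proof.
move=> p; apply/asboolP; exists (qdom p); split=> //; exact: qdomP.
Qed.

Lemma qequiv_sym : symmetric qequiv_rel.
Proof.
have H p q : qequiv_prop p q -> qequiv_prop q p.
  move=> [L [L0 sL e]]; exists L; split=> // [x /sL[]|x Lx] //.
  by rewrite e.
by move=> p q; apply/asboolP/asboolP; apply: H.
Qed.

Lemma qequiv_trans : transitive qequiv_rel.
Proof.
move=> q p r /asboolP[L [L0 sL e]] /asboolP[M [M0 sM e']]; apply/asboolP.
have [sl sr] := (ideal_mul_subl (J := M) L0.1, ideal_mul_subr (I := L) M0.1).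
exists (ideal_mul L M); split; first exact: nonzero_ideal_mul.
  by move=> x Hx; split; [case: (sL x (sl x Hx))|case: (sM x (sr x Hx))].
by move=> x Hx; rewrite e ?e'//; auto.
Qed.

Canonical qequiv := EquivRel qequiv_rel qequiv_refl qequiv_sym qequiv_trans.

Definition martindale := {eq_quot qequiv}.

HB.instance Definition _ := Choice.on martindale.
HB.instance Definition _ := EqQuotient.on martindale.

Lemma martindale_eqP (p q : qpair) :
  (\pi_martindale p = \pi_martindale q) <-> qequiv_prop p q.
Proof.
split; first by move/eqmodP => /asboolP.
by move=> H; apply/eqmodP/asboolP.
Qed.


Definition qadd (p q : qpair) : qpair :=
  @QPair (qdom p `&` qdom q) (fun x => qfun p x + qfun q x)
    (nonzero_idealI primeA (qdomP p) (qdomP q))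
    (right_homD (qfunP p) (qfunP q)).

Definition qmul (p q : qpair) : qpair :=
  @QPair (ideal_mul (qdom q) (qdom p)) (qfun p \o qfun q)
    (nonzero_ideal_mul primeA (qdomP q) (qdomP p))
    (right_hom_comp (qdomP p).1 (qdomP q).1 (qfunP p) (qfunP q)).1.

Definition qscale (k : K) (p : qpair) : qpair :=
  @QPair (qdom p) (fun x => k *: qfun p x) (qdomP p) (right_homZ k (qfunP p)).

(* Its class is the image of k in the Martindale ring. *)
Definition qconst (k : K) : qpair :=
  @QPair setT (fun x => k *: x) nonzero_idealT (right_hom_scale k).

Lemma qequivI (p q : qpair) (L : set A) : nonzero_ideal L ->
  L `<=` qdom p -> L `<=` qdom q -> (forall x, L x -> qfun p x = qfun q x) ->
  \pi_martindale p = \pi_martindale q.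
Proof.
move=> L0 sp sq e; apply/martindale_eqP; exists L; split=> // x Lx.
by split; [apply: sp|apply: sq].
Qed.

Lemma qequivE (p : qpair) : qequiv_prop (repr (\pi_martindale p)) p.
Proof. by apply/martindale_eqP; rewrite reprK. Qed.

Definition madd (x y : martindale) : martindale := \pi_martindale (qadd (repr x) (repr y)).
Definition mmul (x y : martindale) : martindale := \pi_martindale (qmul (repr x) (repr y)).
Definition mscale (k : K) (x : martindale) : martindale :=
  \pi_martindale (qscale k (repr x)).

Lemma maddE p q : madd (\pi_martindale p) (\pi_martindale q) = \pi_martindale (qadd p q).
Proof.
have [L [L0 sL e]] := qequivE p; have [M [M0 sM e']] := qequivE q.
apply: (qequivI (nonzero_idealI primeA L0 M0)).
- by move=> x [/sL[? ?] /sM[? ?]].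
- by move=> x [/sL[? ?] /sM[? ?]].
by move=> x [Lx Mx] /=; rewrite e// e'.
Qed.

Lemma mscaleE k p : mscale k (\pi_martindale p) = \pi_martindale (qscale k p).
Proof.
have [L [L0 sL e]] := qequivE p; apply: (qequivI L0).
- by move=> x /sL[].
- by move=> x /sL[].
by move=> x Lx /=; rewrite e.
Qed.

Lemma mmulE p q : mmul (\pi_martindale p) (\pi_martindale q) = \pi_martindale (qmul p q).
Proof.
have [L [L0 sL e]] := qequivE p; have [M [M0 sM e']] := qequivE q.
have sLp : L `<=` qdom p by move=> x /sL[].
have sMq : M `<=` qdom q by move=> x /sM[].
apply: (qequivI (nonzero_ideal_mul primeA M0 L0)).
- by apply: ideal_mulS => x; [move/sM=> []|move/sL=> []].
- exact: ideal_mulS.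
move=> x Hx /=.
have Mx := ideal_mul_subl M0.1 Hx.
rewrite e'// e//.
exact: (right_hom_comp L0.1 M0.1 (right_homS sLp (qfunP p))
                      (right_homS sMq (qfunP q))).2.
Qed.

Lemma martindaleW (P : martindale -> Prop) :
  (forall p, P (\pi_martindale p)) -> forall x, P x.
Proof. by move=> H x; rewrite -[x]reprK. Qed.

Lemma maddA : associative madd.
Proof.
elim/martindaleW=> p; elim/martindaleW=> q; elim/martindaleW=> r.
rewrite !maddE; apply: (qequivI (nonzero_idealI primeA
  (nonzero_idealI primeA (qdomP p) (qdomP q)) (qdomP r))) => //=.
- by move=> x [[]].
- by move=> x _; rewrite addrA.
Qed.

Lemma maddC : commutative madd.
Proof.
elim/martindaleW=> p; elim/martindaleW=> q; rewrite !maddE.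
apply: (qequivI (nonzero_idealI primeA (qdomP p) (qdomP q))) => //=.
- by move=> x [].
- by move=> x _; rewrite addrC.
Qed.

Lemma madd0 : left_id (\pi_martindale (qconst 0)) madd.
Proof.
elim/martindaleW=> p; rewrite maddE; apply: (qequivI (qdomP p)) => //=.
by move=> x _; rewrite scale0r add0r.
Qed.

Lemma maddN : left_inverse (\pi_martindale (qconst 0)) (mscale (-1)) madd.
Proof.
elim/martindaleW=> p; rewrite mscaleE maddE; apply: (qequivI (qdomP p)) => //=.
by move=> x _; rewrite scale0r scaleN1r addNr.
Qed.

HB.instance Definition _ :=
  GRing.isZmodule.Build martindale maddA maddC madd0 maddN.

Lemma piD p q :
  \pi_martindale p + \pi_martindale q = \pi_martindale (qadd p q).
Proof. exact: maddE. Qed.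

Lemma mmulA : associative mmul.
Proof.
elim/martindaleW=> p; elim/martindaleW=> q; elim/martindaleW=> r.
rewrite !mmulE.
have [[P Q] T] := (qdomP p, qdomP q, qdomP r).
apply: (qequivI (nonzero_ideal_mul primeA T (nonzero_ideal_mul primeA Q P))).
- rewrite /=; apply: ideal_mul_min.
  + exact: ideal_mul0.
  + exact: ideal_mulD.
  + move=> x y Tx; move: y; apply: ideal_mul_min.
    * by rewrite mulr0; exact: ideal_mul0.
    * by move=> y z Hy Hz; rewrite mulrDr; exact: ideal_mulD.
    * by move=> y z Qy Pz; rewrite mulrA; apply: ideal_mulP=> //; apply: ideal_mulP.
- by [].
- by [].
Qed.

Lemma mul1m : left_id (\pi_martindale (qconst 1)) mmul.
Proof.
elim/martindaleW=> p; rewrite mmulE.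
apply: (qequivI (nonzero_ideal_mul primeA (qdomP p) nonzero_idealT)) => //=.
- apply: ideal_mul_subl; exact: (qdomP p).1.
- by move=> x _; rewrite scale1r.
Qed.

Lemma mulm1 : right_id (\pi_martindale (qconst 1)) mmul.
Proof.
elim/martindaleW=> p; rewrite mmulE.
apply: (qequivI (nonzero_ideal_mul primeA nonzero_idealT (qdomP p))) => //=.
- apply: ideal_mul_subr; exact: (qdomP p).1.
- by move=> x _; rewrite scale1r.
Qed.

Lemma mmulDl : left_distributive mmul +%R.
Proof.
elim/martindaleW=> p; elim/martindaleW=> q; elim/martindaleW=> r.
have [[P Q] T] := (qdomP p, qdomP q, qdomP r).
rewrite !(piD, mmulE).
apply: (qequivI (nonzero_ideal_mul primeA T (nonzero_idealI primeA P Q))) => //=.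
by move=> x Hx; split; apply: ideal_mulS Hx => // y [].
Qed.

Lemma mmulDr : right_distributive mmul +%R.
Proof.
elim/martindaleW=> p; elim/martindaleW=> q; elim/martindaleW=> r.
have [[P Q] T] := (qdomP p, qdomP q, qdomP r).
rewrite !(piD, mmulE).
apply: (qequivI (nonzero_ideal_mul primeA (nonzero_idealI primeA Q T) P)) => //=.
  by move=> x Hx; split; apply: ideal_mulS Hx => // y [].
move=> x Hx.
have Hq : ideal_mul (qdom q) (qdom p) x.
  by apply: ideal_mulS Hx => // y [].
have Hr : ideal_mul (qdom r) (qdom p) x.
  by apply: ideal_mulS Hx => // y [].
rewrite (qfunP p).1//.
- exact: (right_hom_comp P.1 Q.1 (qfunP p) (qfunP q)).2.
- exact: (right_hom_comp P.1 T.1 (qfunP p) (qfunP r)).2.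
Qed.

Lemma m1_neq0 : \pi_martindale (qconst 1) != 0.
Proof.
apply/eqP => /martindale_eqP [L [[_ [x Lx x0]] _ /(_ x Lx)]] /=.
by rewrite scale1r scale0r => /eqP; rewrite (negPf x0).
Qed.

HB.instance Definition _ := GRing.Zmodule_isNzRing.Build martindale
  mmulA mul1m mulm1 mmulDl mmulDr m1_neq0.

Lemma piM p q :
  \pi_martindale p * \pi_martindale q = \pi_martindale (qmul p q).
Proof. exact: mmulE. Qed.

Lemma mscaleA a b v : mscale a (mscale b v) = mscale (a * b) v.
Proof.
elim/martindaleW: v => p; rewrite !mscaleE; apply: (qequivI (qdomP p)) => //=.
by move=> x _; rewrite scalerA.
Qed.

Lemma mscale1 : left_id 1 mscale.
Proof.
elim/martindaleW => p; rewrite !mscaleE; apply: (qequivI (qdomP p)) => //=.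
by move=> x _; rewrite scale1r.
Qed.

Lemma mscaleDr : right_distributive mscale +%R.
Proof.
move=> k; elim/martindaleW => p; elim/martindaleW => q.
rewrite !(piD, mscaleE) ?piD.
apply: (qequivI (nonzero_idealI primeA (qdomP p) (qdomP q))) => //=.
by move=> x _; rewrite scalerDr.
Qed.

Lemma mscaleDl v : {morph mscale^~ v : a b / a + b}.
Proof.
move=> a b; elim/martindaleW: v => p.
rewrite !(piD, mscaleE) ?piD; apply: (qequivI (qdomP p)) => //=.
by move=> x _; rewrite scalerDl.
Qed.

HB.instance Definition _ := GRing.Zmodule_isLmodule.Build K martindale
  mscaleA mscale1 mscaleDr mscaleDl.

Lemma piZ k p : k *: \pi_martindale p = \pi_martindale (qscale k p).
Proof. exact: mscaleE. Qed.

Lemma mscaleAl (k : K) (u v : martindale) : k *: (u * v) = (k *: u) * v.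
Proof.
elim/martindaleW: u => p; elim/martindaleW: v => q.
rewrite piM !piZ piM.
by apply: (qequivI (nonzero_ideal_mul primeA (qdomP q) (qdomP p))) => //=.
Qed.

HB.instance Definition _ := GRing.Lmodule_isLalgebra.Build K martindale mscaleAl.

Lemma mscaleAr (k : K) (u v : martindale) : k *: (u * v) = u * (k *: v).
Proof.
elim/martindaleW: u => p; elim/martindaleW: v => q.
rewrite piM !piZ piM.
apply: (qequivI (nonzero_ideal_mul primeA (qdomP q) (qdomP p))) => //= x Hx.
have Ix := (right_hom_comp (qdomP p).1 (qdomP q).1 (qfunP p) (qfunP q)).2 x Hx.
by rewrite -[in RHS]mulr_algr (qfunP p).2// mulr_algr.
Qed.

HB.instance Definition _ := GRing.Lalgebra_isAlgebra.Build K martindale mscaleAr.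

Definition centre : {pred martindale} :=
  fun z => `[< forall y : martindale, z * y = y * z >].

Lemma centreP (z : martindale) :
  reflect (forall y, z * y = y * z) (z \in centre).
Proof. exact: asboolP. Qed.

Lemma centre_subalg_closed : GRing.subalg_closed centre.
Proof.
split.
- by apply/centreP => y; rewrite mul1r mulr1.
- move=> k u v /centreP Hu /centreP Hv; apply/centreP => y.
  by rewrite mulrDl mulrDr Hv -scalerAl Hu scalerAr.
- move=> u v /centreP Hu /centreP Hv; apply/centreP => y.
  by rewrite -mulrA Hv mulrA Hu mulrA.
Qed.

Record extended_centre := ExtendedCentre {
  ecval : martindale;
  ecvalP : ecval \in centre }.

HB.instance Definition _ := [isSub for ecval].
HB.instance Definition _ := [Choice of extended_centre by <:].
HB.instance Definition _ := GRing.SubChoice_isSubAlgebra.Build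
  K martindale centre extended_centre (GRing.subalg_closed_semi centre_subalg_closed).

Lemma extended_centre_mulC : @commutative extended_centre _ *%R.
Proof.
move=> x y; apply: val_inj; rewrite !rmorphM /=.
by have /centreP := ecvalP x; apply.
Qed.

HB.instance Definition _ := GRing.PzRing_hasCommutativeMul.Build extended_centre
  extended_centre_mulC.

End Martindale.

Section Transcendence.
Context {K : fieldType} {C : comAlgType K}.

Definition alg_independent (B : set C) : Prop :=
  forall n (x : 'I_n -> C), injective x -> (forall i, B (x i)) ->
  forall p : mpoly.mpoly n K, mpoly.mmap (in_alg C) x p = 0 -> p = 0.

Definition transcendence_basis (B : set C) : Prop :=
  alg_independent B /\
  forall B' : set C, alg_independent B' -> B `<=` B' -> B' = B.

End Transcendence.

(* Used for a field C, whose transcendence bases all have the same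
   cardinality. *)
Definition infinite_trdeg (K : fieldType) (C : comAlgType K) : Prop :=
  exists2 B : set C, transcendence_basis B & infinite_set B.

(* Main.v *)
Require Import Defs.
From HB Require Import structures.
From mathcomp Require Import all_boot all_order all_algebra.
From mathcomp Require Import all_classical all_reals all_analysis.
From mathcomp Require Import finmap zify lra.
From mathcomp Require mpoly monalg.
Import (canonicals, coercions) monalg mpoly.
Set Implicit Arguments.
Unset Strict Implicit.
Unset Printing Implicit Defensive.
Import Order.TTheory GRing.Theory Num.Theory.
Local Open Scope classical_set_scope.
Local Open Scope quotient_scope.
Local Open Scope ring_scope.

(** Let u be the infinite word that is the limit of the finite words B_k, where
    B_0 is empty and B_(k+1) = B_k y_k x^(g_k) B_k with g_k = 2^(4^(k+1)). Its
    letters are x and the y_k; an occurrence of y_k is said to have type k.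
    Let S = K[t_0, t_1, ...]. The algebra A is the K-algebra generated by three
    upper triangular matrices over S, with rows and columns indexed by nat: the
    entry at (n, n+1) is 1 in X if u_n = x, it is 1 in Y if u_n is some y_k, and
    it is t_k in Z if u_n = y_k; all other entries are 0. So a word w in X, Y, Z
    has all its entries on the diagonal j = i + |w|, and the entry in row i is
    nonzero exactly when w, with Z read as Y and types forgotten, occurs in u at
    place i. The diagonals give the grading.

    Prime: every prefix of u recurs arbitrarily far to the right
    (ruler_recurrent), so nonzero entries of two elements a, b can be joined by
    a word w read off from u. Taking these entries on the lowest nonzero
    diagonals of a and b, no other term contributes to the corresponding entry
    of a w b, which is nonzero because S is a domain (connecting_word).

    Extended centre: the type of a y can be read from the letters that follow,
    since a y of type k is followed by exactly g_k letters x and then a y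
    (factor_marker). Hence Z X^(g_k) Y = t_k Y X^(g_k) Y, so that multiplication
    by t_k carries a nonzero ideal of A into A and is a central element of the
    Martindale ring (denominators_indet, multiplier_central). A polynomial in
    these elements acts as multiplication by the same polynomial in the t_k, and
    S is a domain, so they are algebraically independent; Zorn's lemma extends
    them to a transcendence basis.

    Growth: if n <= g_k, then a factor of u of length at most n also occurs in
    x^n B_k y x^n (ruler_factor), and B_k y has 2^k letters y, each of which may
    be read as Y or Z. Up to a constant this leaves n^2 2^(2^k) words for the
    n-th power of the span of 1, X, Y, Z, with k such that g_(k-1) < n; as g_k
    grows so fast, the second factor is smaller than any power of n. Conversely
    the words x^a B_k y x^b with a, b < g_k / 4 all occur in u, distinct ones
    are linearly independent, and for n = g_k they give (n/4)^2 elements.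

    No identity: cut u at the first y_1, the first y_2, and so on. The segment
    that begins at the first y_i contains the marker of type i, hence occurs at
    the first y_j only if i = j. So the segments multiply like the matrix units
    E_12, E_23, ..., and a suitable substitution isolates any given monomial. *)

(** * Polynomials in countably many indeterminates *)
Section PolynomialRing.
Variable K : fieldType.

Local Notation cpoly := (monalg.malg (monalg.cmonom nat) K).

Definition indet (k : nat) : cpoly := monalg.mkmalgU (monalg.ucm k) 1.

Section Specialization.
Variables (n : nat) (x : 'I_n -> nat).

(** Every indeterminate outside the range of x goes to 0. Each polynomial
    involves finitely many indeterminates, so questions about it can be moved
    to polynomials in n indeterminates. *)
Definition specialize_mon (m : monalg.cmonom nat) : mpoly.mpoly n K :=
  if all (fun i => i \in codom x) (finsupp (monalg.cmonom_val m))
  then mpoly.mpolyX K (mpoly.Multinom [tuple m (x i) | i < n]) else 0.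

Lemma specialize_mon_morphism : monalg.mmorphism specialize_mon.
Proof.
split=> [m1 m2|]; last first.
  rewrite /specialize_mon monalg.mdom1 /= -mpoly.mpolyX0; congr mpoly.mpolyX.
  by apply/mpoly.mnmP => i; rewrite mpoly.mnmE mpoly.mnm0E monalg.cm1.
rewrite /specialize_mon monalg.mdomD.
have -> : all (fun i => i \in codom x)
    (finsupp (monalg.cmonom_val m1) `|` finsupp (monalg.cmonom_val m2))%fset =
    all (fun i => i \in codom x) (finsupp (monalg.cmonom_val m1)) &&
    all (fun i => i \in codom x) (finsupp (monalg.cmonom_val m2)).
  apply/idP/andP => [/allP H|[/allP H1 /allP H2]].
    by split; apply/allP => i Hi; apply: H; rewrite in_fsetU Hi ?orbT.
  by apply/allP => i; rewrite in_fsetU => /orP[/H1|/H2].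
case: ifP => [/andP[-> ->]|]; last first.
  by case: ifP => _ /=; [move=> ->; rewrite mulr0|rewrite mul0r].
rewrite -mpoly.mpolyXD; congr mpoly.mpolyX.
by apply/mpoly.mnmP => i; rewrite mpoly.mnmE mpoly.mnmDE !mpoly.mnmE monalg.cmM.
Qed.

Definition specialize_mmorphism : monalg.MMorphism.type _ _ :=
  monalg.MMorphism.Pack (monalg.MMorphism.Class
    (@monalg.isMultiplicative.Axioms_ _ _ specialize_mon specialize_mon_morphism)).

Definition specialize : cpoly -> mpoly.mpoly n K :=
  monalg.mmap (@mpoly.mpolyC n K) specialize_mmorphism.

HB.instance Definition _ := GRing.RMorphism.on specialize.

Lemma specialize_indet i : injective x ->
  specialize (indet (x i)) = mpoly.mpolyX K (mpoly.mnm1 i).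
Proof.
move=> inj; rewrite /specialize /indet monalg.mmapU /= mpoly.mpolyC1 mul1r /specialize_mon.
rewrite monalg.mdomU.
have -> : all (fun j => j \in codom x) [fset x i]%fset.
  by apply/allP => j; rewrite in_fset1 => /eqP ->; exact: codom_f.
congr mpoly.mpolyX; apply/mpoly.mnmP => j; rewrite mpoly.mnmE mpoly.mnm1E monalg.cmU.
by rewrite (inj_eq inj).
Qed.

Lemma specialize_indet0 j : j \notin codom x -> specialize (indet j) = 0.
Proof.
move=> /negPf jx; rewrite /specialize /indet monalg.mmapU /= mpoly.mpolyC1 mul1r.
rewrite /specialize_mon monalg.mdomU (_ : all _ _ = false)//=.
by apply/negP => /allP /(_ j); rewrite in_fset1 eqxx jx => /(_ isT).
Qed.

End Specialization.

Lemma indet_inj : injective indet.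
Proof.
move=> k l e; apply: contrapT => kl; pose x := fun _ : 'I_1 => k.
have := specialize_indet (ord0 : 'I_1) (_ : injective x).
rewrite /x e specialize_indet0 => [H|]; last by apply/codomP => -[_ lk]; exact: kl.
have /H {}H : injective (fun _ : 'I_1 => k) by move=> i j _; rewrite !ord1.
have := congr1 (mpoly.mcoeff (mpoly.mnm1 ord0)) H.
rewrite mpoly.mcoeff0 mpoly.mcoeffX eqxx => /esym/eqP.
by rewrite oner_eq0.
Qed.

(** Specializing at x sends indet (x i) to the i-th indeterminate, hence the
    value of p at these elements back to p itself. *)
Lemma indet_alg_independent n (x : 'I_n -> nat) : injective x ->
  forall p : mpoly.mpoly n K, mpoly.mmap (in_alg cpoly) (indet \o x) p = 0 -> p = 0.
Proof.
move=> inj p /(congr1 (specialize x)); rewrite rmorph0 => e.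
rewrite -[RHS]e {1}[p]mpoly.mpolyE /mpoly.mmap raddf_sum.
apply: eq_bigr => m _; rewrite [RHS]/= rmorphM /= /mpoly.mmap1 rmorph_prod mpoly.mpolyXE_id.
rewrite -mpoly.mul_mpolyC; congr (_ * _).
  by rewrite -monalg.mul_malgC mulr1 /specialize monalg.mmapC.
by apply: eq_bigr => i _; rewrite rmorphXn /= specialize_indet.
Qed.

Lemma mcoeff_specialize N (p : cpoly) (m : monalg.cmonom nat) :
  all (fun i => i < N)%N (finsupp (monalg.cmonom_val m)) ->
  mpoly.mcoeff (mpoly.Multinom [tuple m i | i < N]) (specialize (@nat_of_ord N) p) =
  monalg.mcoeff m p.
Proof.
have codomE i : (i \in codom (@nat_of_ord N)) = (i < N)%N.
  by apply/codomP/idP => [[j ->]//|iN]; exists (Ordinal iN).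
move=> mN; rewrite /specialize (monalg.mmapEw (fsubsetUl (monalg.msupp p) [fset m]%fset)).
have mP : m \in (monalg.msupp p `|` [fset m])%fset.
  by rewrite in_fsetU in_fset1 eqxx orbT.
rewrite (big_fsetD1 m)//= raddfD /= raddf_sum /= big1_seq ?addr0 /specialize_mon.
  rewrite (_ : all _ _).
    by rewrite mpoly.mcoeffCM mpoly.mcoeffX eqxx mulr1.
  by apply: sub_all mN => i; rewrite codomE.
move=> k /andP[_]; rewrite in_fsetD1 => /andP[km _].
case: ifP => [/allP kN|]; last by rewrite mulr0 raddf0.
rewrite mpoly.mcoeffCM mpoly.mcoeffX; case: eqP => [e|]; last by rewrite mulr0.
case/eqP: km; apply/eqP/monalg.cmP => i.
have [iN|iN] := ltnP i N.
  by move/mpoly.mnmP: e => /(_ (Ordinal iN)); rewrite !mpoly.mnmE.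
have /eqP -> : k i == 0%N.
  by rewrite monalg.cmE_eq0; apply/negP => /kN; rewrite codomE ltnNge iN.
apply/esym/eqP; rewrite monalg.cmE_eq0; apply/negP => /(allP mN).
by rewrite ltnNge iN.
Qed.

Lemma specialize_neq0 (p : cpoly) : p != 0 ->
  exists N0, forall N, (N0 <= N)%N -> specialize (@nat_of_ord N) p != 0.
Proof.
move=> p0; have [m mp] : exists m, monalg.mcoeff m p != 0.
  apply: contrapT => H; move/eqP: p0; apply; apply/monalg.malgP => m.
  rewrite monalg.mcoeff0; apply: contrapT => /eqP mp; apply: H; by exists m.
exists (\max_(i <- finsupp (monalg.cmonom_val m)) i.+1)%N => N HN.
apply/eqP => e; move/eqP: mp; apply; rewrite -(@mcoeff_specialize N).
  by rewrite e mpoly.mcoeff0.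
apply/allP => i im; apply: leq_trans HN; exact: (leq_bigmax_seq _ im).
Qed.

(** Two nonzero elements stay nonzero in the polynomials in the first N
    indeterminates for N large, and these form a domain. *)
Lemma cpoly_domain (p q : cpoly) : p * q = 0 -> p = 0 \/ q = 0.
Proof.
have [->|p0] := eqVneq p 0; first by left.
have [->|q0] := eqVneq q 0; first by right.
have [M /(_ (maxn M _)) HM] := specialize_neq0 p0.
have [N /(_ (maxn M N) (leq_maxr _ _)) HN] := specialize_neq0 q0.
move=> /(congr1 (specialize (@nat_of_ord (maxn M N)))) /eqP.
by rewrite rmorphM rmorph0 mulf_eq0 (negPf HN) (negPf (HM _ (leq_maxl _ _))).
Qed.

End PolynomialRing.

(** * The ruler word *)
Section RulerWord.
Local Open Scope nat_scope.

Definition gap k := 2 ^ (4 ^ k.+1).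

Fixpoint block k : seq (option nat) :=
  if k is j.+1 then block j ++ Some j :: nseq (gap j) None ++ block j else [::].

(** The letter x is None, and y_k is Some k. Since block n.+1 has more than n
    letters, the default value of nth is never used. The types follow the ruler
    sequence 0, 1, 0, 2, 0, 1, 0, 3, ... *)
Definition ruler n : option nat := nth None (block n.+1) n.

Lemma gap_gt0 k : 0 < gap k.
Proof. by rewrite expn_gt0. Qed.

Lemma gap_mono j k : j < k -> gap j < gap k.
Proof. by move=> jk; rewrite ltn_exp2l// ltn_exp2l// ltnS. Qed.

Lemma gap_leq j k : j <= k -> gap j <= gap k.
Proof. by rewrite leq_eqVlt => /orP[/eqP->//|/gap_mono/ltnW]. Qed.

Lemma gap_inj : injective gap.
Proof.
move=> j k; case: (ltngtP j k) => // /gap_mono; first by move=> + e; rewrite e ltnn.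
by move=> + e; rewrite e ltnn.
Qed.

Lemma gap_gt k : k < gap k.
Proof.
apply: (@leq_trans (k.+1)) => //; apply: leq_trans (ltnW (ltn_expl _ (isT : 1 < 4))) _.
by apply: ltnW; exact: ltn_expl.
Qed.

Lemma size_blockS k :
  size (block k.+1) = (size (block k)).*2 + (gap k).+1.
Proof. by rewrite /= !size_cat /= size_cat size_nseq -addnn; lia. Qed.

(** B_k is short compared with the gap of type k, since
    gap k.+1 = gap k ^ 4. *)
Lemma size_block_gap k : 8 * size (block k) <= gap k /\ 8 <= gap k.
Proof.
elim: k => [|k [IH1 IH2]]; first by rewrite muln0 /gap.
have -> : gap k.+1 = gap k ^ 4 by rewrite /gap -expnM -expnSr.
rewrite size_blockS; have : gap k * 32 <= gap k ^ 4.
  rewrite expnS leq_pmul2l ?gap_gt0//; apply: (@leq_trans (8 ^ 3)) => //.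
  by rewrite leq_exp2r.
lia.
Qed.

Lemma size_blockS_le k : size (block k.+1) <= 2 * gap k.
Proof. by rewrite size_blockS; have := size_block_gap k; lia. Qed.

Lemma leq_size_block k : k <= size (block k).
Proof. by elim: k => // k IH; rewrite size_blockS; lia. Qed.

Lemma size_block_mono j k : j <= k -> size (block j) <= size (block k).
Proof.
move=> /subnK<-; elim: (k - j) => // i IH; apply: leq_trans IH _.
by rewrite addSn size_blockS; lia.
Qed.

Lemma nth_block_prefix j k n : j <= k -> n < size (block j) ->
  nth None (block k) n = nth None (block j) n.
Proof.
move=> jk nj; rewrite -(subnK jk); elim: (k - j) => // i <-.
by rewrite addSn /= nth_cat (leq_trans nj)// size_block_mono// leq_addl.
Qed.

Lemma ruler_block k n : n < size (block k) -> ruler n = nth None (block k) n.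
Proof.
move=> nk; have nS : n < size (block n.+1) by apply: leq_size_block.
have [kn|] := leqP k n; first by rewrite /ruler (@nth_block_prefix k) // ltnW.
by move=> nk'; rewrite /ruler -(nth_block_prefix nk').
Qed.

(** B_(j+1) = B_j y_j x^(g_j) B_j contains a second copy of B_j. *)
Lemma ruler_recurrent N M : exists2 s, M <= s & forall n, n < N -> ruler (n + s) = ruler n.
Proof.
pose j := maxn N M.
have Nj : N <= size (block j) by apply: leq_trans (leq_size_block _); rewrite leq_maxl.
have Mj : M <= size (block j) by apply: leq_trans (leq_size_block _); rewrite leq_maxr.
exists (size (block j) + (gap j).+1); first by lia.
move=> n nN; have nj := leq_trans nN Nj.
rewrite (ruler_block nj) (@ruler_block j.+1); last by rewrite size_blockS; lia.
rewrite /= nth_cat ltnNge (leq_trans (leq_addr _ _) (leq_addl n _)) /=.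
have -> : n + (size (block j) + (gap j).+1) - size (block j) = (gap j + n).+1 by lia.
by rewrite /= nth_cat size_nseq ltnNge leq_addr /= addKn.
Qed.

Lemma ruler_size_block k : ruler (size (block k)) = Some k.
Proof.
rewrite (@ruler_block k.+1); last by rewrite size_blockS; lia.
by rewrite /= nth_cat ltnn subnn.
Qed.

Lemma head_block k : 0 < k -> exists j, nth None (block k) 0 = Some j.
Proof.
case: k => // k _; exists 0; rewrite (@nth_block_prefix 1)//.
Qed.

(** B_k is followed in the word by a letter y_c, so a gap that ends with B_k is
    bounded by it; appending a letter makes this part of the induction. *)
Lemma block_followed k n j : nth None (block k) n = Some j ->
  [/\ forall c i, i < gap j -> nth None (rcons (block k) c) (n + i.+1) = None,
      forall c, exists c', nth None (rcons (block k) (Some c)) (n + (gap j).+1) = Some c'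
    & n + (gap j).+1 <= size (block k)].
Proof.
elim: k n => [|k IH] n; first by rewrite nth_nil.
have key c : rcons (block k.+1) c =
    rcons (block k) (Some k) ++ nseq (gap k) None ++ rcons (block k) c.
  by rewrite /= -!cats1 -!catA /= -!catA.
have [nk|kn] := ltnP n (size (block k)).
  rewrite /= nth_cat nk => /IH [H1 H2 H3]; split.
  - move=> c i ij; rewrite key nth_cat size_rcons ifT; last by lia.
    exact: H1.
  - move=> c; rewrite key nth_cat size_rcons ifT; last by lia.
    exact: H2.
  - by rewrite size_blockS in H3 *; lia.
have [->|nk] := eqVneq n (size (block k)).
  rewrite /= nth_cat ltnn subnn /= => -[<-]; split.
  - move=> c i ij; rewrite key nth_cat size_rcons ifF; last by lia.
    rewrite nth_cat size_nseq ifT; last by lia.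
    by rewrite nth_nseq; case: ifP.
  - move=> c; rewrite key nth_cat size_rcons ifF; last by lia.
    rewrite nth_cat size_nseq ifF; last by lia.
    have -> : size (block k) + (gap k).+1 - (size (block k)).+1 - gap k = 0 by lia.
    case: (posnP k) => [->|/head_block [c' c'E]]; first by exists c.
    exists c'; rewrite nth_rcons ifT// (leq_trans _ (leq_size_block _))//.
    by case: k c'E {IH key kn}.
  - by rewrite -[_ ++ _]/(block k.+1) size_blockS; lia.
have [nk'|kn'] := ltnP n (size (block k) + (gap k).+1).
  rewrite /= nth_cat ifF; last by lia.
  have -> : n - size (block k) = (n - (size (block k)).+1).+1 by lia.
  rewrite /= nth_cat size_nseq ifT; last by lia.
  by rewrite nth_nseq; case: ifP.
pose p := n - (size (block k) + (gap k).+1).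
have -> : n = size (block k) + (gap k).+1 + p by rewrite /p; lia.
have drop_ i c :
    nth None (rcons (block k.+1) c) (size (block k) + (gap k).+1 + p + i) =
    nth None (rcons (block k) c) (p + i).
  rewrite key nth_cat size_rcons ifF; last by lia.
  rewrite nth_cat size_nseq ifF; last by lia.
  by congr nth; lia.
rewrite /= nth_cat ifF; last by lia.
have -> : size (block k) + (gap k).+1 + p - size (block k) = (gap k + p).+1 by lia.
rewrite /= nth_cat size_nseq ifF; last by lia.
rewrite addKn => /IH [H1 H2 H3]; split.
- by move=> c i ij; rewrite -[_ ++ _]/(block k.+1) drop_; exact: H1.
- by move=> c; rewrite -[_ ++ _]/(block k.+1) drop_; exact: H2.
- by rewrite -[_ ++ _]/(block k.+1) size_blockS; lia.
Qed.

Lemma ruler_followed n k : ruler n = Some k ->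
  (forall i, i < gap k -> ruler (n + i.+1) = None) /\
  exists c, ruler (n + (gap k).+1) = Some c.
Proof.
move=> nk; have nS : n < size (block n.+1) by apply: leq_size_block.
have /block_followed [H1 H2 H3] : nth None (block n.+1) n = Some k by [].
have rE i : i <= (gap k).+1 ->
    ruler (n + i) = nth None (rcons (block n.+1) (Some n.+1)) (n + i).
  move=> ik; rewrite nth_rcons; have [lt|] := ltnP; first exact: ruler_block.
  move=> le; have -> : n + i = size (block n.+1) by lia.
  by rewrite eqxx ruler_size_block.
by split=> [i ik|]; rewrite rE ?ltnS; [exact: H1|exact: ltnW|exact: H2|].
Qed.

(** In B_(k+2) there is a copy of B_k between a gap of type k and the letter
    y_(k+1), which is itself followed by a longer gap. *)
Lemma ruler_long_runs k a b : a <= gap k -> b <= gap k ->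
  exists n, forall i, i < a + size (block k) + 1 + b ->
    ruler (n + i) = nth None (nseq a None ++ rcons (block k) (Some k.+1)) i.
Proof.
move=> ak bk; exists (size (block k) + 1 + (gap k - a)) => i ib.
have bk1 : b <= gap k.+1 by apply: leq_trans bk _; exact: gap_leq.
rewrite (@ruler_block k.+2); last by rewrite size_blockS size_blockS; lia.
have -> : block k.+2 = rcons (block k) (Some k) ++ nseq (gap k - a) None ++ nseq a None ++
   (rcons (block k) (Some k.+1)) ++ nseq (gap k.+1) None ++ block k.+1.
  rewrite (catA (nseq (gap k - a) None)) -nseqD subnK//.
  by rewrite /= -!cats1 -!catA /= -!catA.
rewrite nth_cat size_rcons ifF; last by lia.
rewrite nth_cat size_nseq ifF; last by lia.
have -> : size (block k) + 1 + (gap k - a) + i - (size (block k)).+1 - (gap k - a) = i by lia.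
rewrite catA nth_cat size_cat size_nseq size_rcons; case: ifP => // /negbT ik.
rewrite nth_cat size_nseq ifT; last by lia.
rewrite nth_nseq ifT; last by lia.
by rewrite nth_default// size_cat size_nseq size_rcons; lia.
Qed.

(** Read with None as default value, this is B_k y_c preceded by n letters x
    and followed by infinitely many. *)
Definition padded_block n k c := nseq n None ++ rcons (block k) (Some c) : seq (option nat).

Definition erase_type : option nat -> option bool := omap (fun=> false).

(** The gap of type k in the middle of B_(k+1) is at least as long as the
    factor, which therefore does not meet both copies of B_k. *)
Lemma padded_block_factor n k p c c' : n <= gap k ->
  exists q, forall i, i < n ->
    erase_type (nth None (padded_block n k.+1 c) (p + i)) =
    erase_type (nth None (padded_block n k c') (q + i)).
Proof.
move=> nk; have E d : padded_block n k.+1 d = padded_block n k k ++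
   nseq (gap k) None ++ rcons (block k) (Some d).
  by rewrite /padded_block /= -!cats1 -!catA /= -!catA.
have sz d : size (padded_block n k d) = n + (size (block k)).+1.
  by rewrite size_cat size_nseq size_rcons.
have change i : erase_type (nth None (padded_block n k k) i) =
                erase_type (nth None (padded_block n k c') i).
  rewrite !nth_cat; case: ifP => // _; rewrite !nth_rcons; case: ifP => // _.
  by case: ifP.
have [pk|kp] := leqP p (n + (size (block k)).+1).
  exists p => i ik; rewrite E nth_cat sz -change; case: ifP => // /negbT lt.
  rewrite nth_cat size_nseq ifT; last by lia.
  by rewrite nth_nseq ifT ?[in RHS]nth_default ?sz//; lia.
have [pk'|kp'] := ltnP p ((size (block k)).+1 + gap k).
  (* The factor lies inside the middle gap: it consists of letters x only. *)
  exists 0 => i ik; rewrite E nth_cat sz ifF; last by lia.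
  rewrite [in RHS]nth_cat size_nseq ifT// nth_nseq if_same.
  rewrite nth_cat size_nseq ifT; last by lia.
  by rewrite nth_nseq if_same.
exists (p - ((size (block k)).+1 + gap k)) => i ik.
rewrite -change E nth_cat sz ifF; last by lia.
rewrite !nth_cat !size_nseq !nth_nseq !if_same.
case: ifP => H1; case: ifP => H2; rewrite //; try lia.
rewrite !nth_rcons.
have -> : p + i - (n + (size (block k)).+1) - gap k =
    p - ((size (block k)).+1 + gap k) + i - n by lia.
by case: ifP => // _; case: ifP.
Qed.

(** Iterating padded_block_factor goes down from a block that contains the
    whole factor to B_k. The bound on q makes the possible factors finitely
    many. *)
Lemma ruler_factor n k p : n <= gap k ->
  exists2 q, q <= n + (size (block k)).+1 & forall i, i < n ->
    erase_type (ruler (p + i)) = erase_type (nth None (padded_block n k 0) (q + i)).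
Proof.
move=> nk; have sz j d : size (padded_block n j d) = n + (size (block j)).+1.
  by rewrite size_cat size_nseq size_rcons.
have descend j q c : k <= j -> exists q', forall i, i < n ->
    erase_type (nth None (padded_block n j c) (q + i)) =
    erase_type (nth None (padded_block n k 0) (q' + i)).
  move=> /subnK<-; elim: (j - k) q c => [|i IH] q c.
    exists q => i _; rewrite !nth_cat; case: ifP => // _; rewrite !nth_rcons.
    by case: ifP => // _; case: ifP.
  have [q1 H1] := @padded_block_factor n (i + k) q c 0 (leq_trans nk (gap_leq (leq_addl _ _))).
  by have [q2 H2] := IH q1 0; exists q2 => l ln; rewrite -H2// -H1.
pose J := k + (p + n); have [q Hq] := @descend J (n + p) 0 (leq_addr _ _).
have rq i : i < n ->
    erase_type (ruler (p + i)) = erase_type (nth None (padded_block n k 0) (q + i)).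
  move=> ik; have lt : p + i < size (block J).
    by apply: leq_trans (leq_size_block _); rewrite /J; lia.
  rewrite -Hq// nth_cat size_nseq ifF; last by lia.
  have -> : n + p + i - n = p + i by lia.
  by rewrite nth_rcons lt (ruler_block lt).
have [qle|qgt] := leqP q (n + (size (block k)).+1); first by exists q.
exists (n + (size (block k)).+1) => // i ik.
by rewrite rq// !nth_default// sz; lia.
Qed.

Lemma count_block k : (count isSome (block k)).+1 = 2 ^ k.
Proof.
elim: k => // k IH; rewrite expnS -IH /= count_cat /= count_cat count_nseq /=; lia.
Qed.

End RulerWord.

(** * Upper triangular infinite matrices *)
#[local] Obligation Tactic := idtac.

Section UpperTriangular.
Variables (K : fieldType) (R : comAlgType K).

(** Entries below the diagonal are 0, so all sums in a product are finite. *)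
Record utmx := Utmx {
  utval : nat -> nat -> R;
  utvalP : forall i j, (j < i)%N -> utval i j = 0 }.

Coercion utval : utmx >-> Funclass.

HB.instance Definition _ := gen_eqMixin utmx.
HB.instance Definition _ := gen_choiceMixin utmx.

Lemma utmxP (f g : utmx) : (forall i j, f i j = g i j) -> f = g.
Proof.
move=> e; have {}e : utval f = utval g by apply/funext => i; apply/funext => j.
by case: f g e => f fP [g gP] /= e; subst g; congr Utmx; exact: Prop_irrelevance.
Qed.

Definition utmx0 := @Utmx (fun _ _ => 0) (fun _ _ _ => erefl).
Program Definition utmx_add (f g : utmx) := @Utmx (fun i j => f i j + g i j) _.
Next Obligation. by move=> f g i j ij /=; rewrite !utvalP// addr0. Qed.
Program Definition utmx_opp (f : utmx) := @Utmx (fun i j => - f i j) _.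
Next Obligation. by move=> f i j ij /=; rewrite utvalP// oppr0. Qed.
Program Definition utmx_rscale (r : R) (f : utmx) := @Utmx (fun i j => r * f i j) _.
Next Obligation. by move=> r f i j ij /=; rewrite utvalP// mulr0. Qed.
Program Definition utmx_scale (k : K) (f : utmx) := @Utmx (fun i j => k *: f i j) _.
Next Obligation. by move=> r f i j ij /=; rewrite utvalP// scaler0. Qed.
Program Definition utmx1 := @Utmx (fun i j => (i == j)%:R) _.
Next Obligation. by move=> i j ij /=; rewrite gtn_eqF. Qed.
Program Definition utmx_mul (f g : utmx) :=
  @Utmx (fun i j => \sum_(k < j.+1) f i k * g k j) _.
Next Obligation.
move=> f g i j ij /=; rewrite big1// => k _.
by rewrite utvalP ?mul0r// (leq_trans (ltn_ord k)).
Qed.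

Fact utmx_addA : associative utmx_add.
Proof. by move=> f g h; apply: utmxP => i j; rewrite /= addrA. Qed.
Fact utmx_addC : commutative utmx_add.
Proof. by move=> f g; apply: utmxP => i j; rewrite /= addrC. Qed.
Fact utmx_add0 : left_id utmx0 utmx_add.
Proof. by move=> f; apply: utmxP => i j; rewrite /= add0r. Qed.
Fact utmx_addN : left_inverse utmx0 utmx_opp utmx_add.
Proof. by move=> f; apply: utmxP => i j; rewrite /= addNr. Qed.

HB.instance Definition _ :=
  GRing.isZmodule.Build utmx utmx_addA utmx_addC utmx_add0 utmx_addN.

(** Terms beyond the column index vanish, so the bound of the sum may be any
    larger one; associativity is then proved as for square matrices. *)
Lemma utmx_mul_wide (f g : utmx) i j n : (j < n)%N ->
  utmx_mul f g i j = \sum_(k < n) f i k * g k j.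
Proof.
move=> jn /=; rewrite (big_ord_widen _ (fun k => f i k * g k j) jn) big_mkcond.
apply: eq_bigr => k _; case: ifP => // /negbT; rewrite -leqNgt => jk.
by rewrite (@utvalP g)// mulr0.
Qed.

Fact utmx_mulA : associative utmx_mul.
Proof.
move=> f g h; apply: utmxP => i j; rewrite /=.
transitivity (\sum_(k < j.+1) \sum_(l < j.+1) f i l * g l k * h k j).
  rewrite exchange_big; apply: eq_bigr => l _ /=.
  by rewrite mulr_sumr; apply: eq_bigr => k _; rewrite mulrA.
apply: eq_bigr => k _; rewrite -mulr_suml; congr (_ * _).
by rewrite -utmx_mul_wide.
Qed.

Fact utmx_mul1 : left_id utmx1 utmx_mul.
Proof.
move=> f; apply: utmxP => i j /=; have [ij|ji] := leqP i j; last first.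
  rewrite (utvalP f)// big1// => k _; rewrite gtn_eqF ?mul0r//.
  exact: leq_trans (ltn_ord k) ji.
rewrite (bigD1 (Ordinal (ij : i < j.+1)%N))//= eqxx mul1r big1 ?addr0// => k.
by rewrite -val_eqE/= eq_sym => /negPf ->; rewrite mul0r.
Qed.

Fact utmx_mulr1 : right_id utmx1 utmx_mul.
Proof.
move=> f; apply: utmxP => i j /=; rewrite (bigD1 ord_max)//= eqxx mulr1.
by rewrite big1 ?addr0// => k; rewrite -val_eqE/= => /negPf ->; rewrite mulr0.
Qed.

Fact utmx_mulDl : left_distributive utmx_mul utmx_add.
Proof.
move=> f g h; apply: utmxP => i j /=; rewrite -big_split /=.
by apply: eq_bigr => k _; rewrite mulrDl.
Qed.

Fact utmx_mulDr : right_distributive utmx_mul utmx_add.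
Proof.
move=> f g h; apply: utmxP => i j /=; rewrite -big_split /=.
by apply: eq_bigr => k _; rewrite mulrDr.
Qed.

Fact utmx1_neq0 : utmx1 != 0.
Proof.
apply/eqP => /(congr1 (fun f : utmx => f 0%N 0%N)) /= /eqP.
by rewrite oner_eq0.
Qed.

HB.instance Definition _ := GRing.Zmodule_isNzRing.Build utmx
  utmx_mulA utmx_mul1 utmx_mulr1 utmx_mulDl utmx_mulDr utmx1_neq0.

Fact utmx_scaleA a b (f : utmx) :
  utmx_scale a (utmx_scale b f) = utmx_scale (a * b) f.
Proof. by apply: utmxP => i j; rewrite /= scalerA. Qed.
Fact utmx_scale1 : left_id 1 utmx_scale.
Proof. by move=> f; apply: utmxP => i j; rewrite /= scale1r. Qed.
Fact utmx_scaleDr : right_distributive utmx_scale +%R.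
Proof. by move=> k f g; apply: utmxP => i j; rewrite /= scalerDr. Qed.
Fact utmx_scaleDl f : {morph utmx_scale^~ f : a b / a + b}.
Proof. by move=> a b; apply: utmxP => i j; rewrite /= scalerDl. Qed.

HB.instance Definition _ := GRing.Zmodule_isLmodule.Build K utmx
  utmx_scaleA utmx_scale1 utmx_scaleDr utmx_scaleDl.

Fact utmx_scaleAl (k : K) (f g : utmx) : k *: (f * g) = k *: f * g.
Proof.
apply: utmxP => i j /=; rewrite scaler_sumr; apply: eq_bigr => l _.
by rewrite scalerAl.
Qed.

HB.instance Definition _ := GRing.Lmodule_isLalgebra.Build K utmx utmx_scaleAl.

Fact utmx_scaleAr (k : K) (f g : utmx) : k *: (f * g) = f * (k *: g).
Proof.
apply: utmxP => i j /=; rewrite scaler_sumr; apply: eq_bigr => l _.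
by rewrite scalerAr.
Qed.

HB.instance Definition _ := GRing.Lalgebra_isAlgebra.Build K utmx utmx_scaleAr.

Lemma utmx1E i j : (1 : utmx) i j = (i == j)%:R. Proof. by []. Qed.
Lemma utmxM (f g : utmx) i j : (f * g) i j = \sum_(k < j.+1) f i k * g k j.
Proof. by []. Qed.

Lemma utmx_rscaleD r f g : utmx_rscale r (f + g) = utmx_rscale r f + utmx_rscale r g.
Proof. by apply: utmxP => i j /=; rewrite mulrDr. Qed.

Lemma utmx_rscaleMl r f g : utmx_rscale r (f * g) = utmx_rscale r f * g.
Proof.
by apply: utmxP => i j /=; rewrite mulr_sumr; apply: eq_bigr => k _; rewrite mulrA.
Qed.

Lemma utmx_rscaleMr r f g : utmx_rscale r (f * g) = f * utmx_rscale r g.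
Proof.
apply: utmxP => i j /=; rewrite mulr_sumr; apply: eq_bigr => k _.
by rewrite mulrCA.
Qed.

End UpperTriangular.

(** * The algebra of the ruler word *)
Section RulerAlgebra.
Variables (K : fieldType) (R : comAlgType K) (t : nat -> R).

Local Notation letter := (option bool).
Local Notation utmx := (utmx R).

(** The generators X, Y, Z are the letters None, Some false, Some true. *)
Definition letter_weight (c : letter) (o : option nat) : R :=
  match c, o with
  | None, None => 1
  | Some b, Some k => if b then t k else 1
  | _, _ => 0
  end.

Fixpoint word_weight (w : seq letter) (i : nat) : R :=
  if w is c :: w' then letter_weight c (ruler i) * word_weight w' i.+1 else 1.

Program Definition word (w : seq letter) : utmx :=
  @Utmx _ _ (fun i j => if j == (i + size w)%N then word_weight w i else 0) _.
Next Obligation.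
by move=> w i j ji /=; case: eqP => // e; move: ji; rewrite e ltnNge leq_addr.
Qed.

Lemma word_weight_cat v w i :
  word_weight (v ++ w) i = word_weight v i * word_weight w (i + size v)%N.
Proof.
elim: v i => [|c v IH] i /=; first by rewrite mul1r addn0.
by rewrite IH mulrA addSnnS.
Qed.

Lemma wordE w i j : word w i j = if j == (i + size w)%N then word_weight w i else 0.
Proof. by []. Qed.

Lemma word_diag w i : word w i (i + size w)%N = word_weight w i.
Proof. by rewrite wordE eqxx. Qed.

Lemma word_mul w (f : utmx) i j :
  (word w * f) i j = word_weight w i * f (i + size w)%N j.
Proof.
rewrite utmxM; have [le|lt] := leqP (i + size w) j; last first.
  rewrite (utvalP f)// mulr0 big1// => k _; rewrite wordE ifF ?mul0r//.
  by apply/negP => /eqP e; have := leq_trans (ltn_ord k) lt; rewrite e ltnn.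
rewrite (bigD1 (Ordinal (le : i + size w < j.+1)%N))//= eqxx big1 ?addr0// => k.
by rewrite -val_eqE/= => /negPf ->; rewrite mul0r.
Qed.

Lemma word_cat v w : word (v ++ w) = word v * word w.
Proof.
apply: utmxP => i j; rewrite word_mul !wordE size_cat addnA word_weight_cat.
by case: ifP => // _; rewrite mulr0.
Qed.

Lemma word_nil : word [::] = 1.
Proof. by apply: utmxP => i j; rewrite wordE utmx1E addn0 eq_sym; case: eqP. Qed.

(** The words form a monoid under multiplication, so their linear span is the
    subalgebra generated by the three letters. *)
Definition word_span : {pred utmx} := fun f =>
  `[< exists l : seq (K * seq letter), f = \sum_(x <- l) x.1 *: word x.2 >].

Lemma word_spanW w : word w \in word_span.
Proof. by apply/asboolP; exists [:: (1, w)]; rewrite big_seq1 scale1r. Qed.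

Lemma word_span_subalg_closed : GRing.subalg_closed word_span.
Proof.
split.
- by rewrite -word_nil word_spanW.
- move=> k f g /asboolP[l ->] /asboolP[l' ->]; apply/asboolP.
  exists ([seq (k * x.1, x.2) | x <- l] ++ l').
  rewrite big_cat big_map /=; congr (_ + _); rewrite scaler_sumr.
  by apply: eq_bigr => x _; rewrite scalerA.
- move=> f g /asboolP[l ->] /asboolP[l' ->]; apply/asboolP.
  exists [seq (x.1 * y.1, x.2 ++ y.2) | x <- l, y <- l'].
  rewrite big_allpairs_dep mulr_suml; apply: eq_bigr => x _.
  rewrite mulr_sumr; apply: eq_bigr => y _ /=.
  by rewrite word_cat -scalerAl -scalerAr scalerA.
Qed.

Record ruler_alg := RulerAlg {
  raval : utmx;
  ravalP : raval \in word_span }.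

HB.instance Definition _ := [isSub for raval].
HB.instance Definition _ := [Choice of ruler_alg by <:].
HB.instance Definition _ := GRing.SubChoice_isSubAlgebra.Build
  K utmx word_span ruler_alg (GRing.subalg_closed_semi word_span_subalg_closed).

Definition rword w : ruler_alg := RulerAlg (word_spanW w).

Lemma rword_cat v w : rword (v ++ w) = rword v * rword w.
Proof. by apply: val_inj; rewrite rmorphM /= word_cat. Qed.

Lemma rword_nil : rword [::] = 1.
Proof. by apply: val_inj; rewrite rmorph1 /= word_nil. Qed.

Lemma ruler_algP (a : ruler_alg) : exists l : seq (K * seq letter),
  a = \sum_(x <- l) x.1 *: rword x.2.
Proof.
have /asboolP[l e] := ravalP a; exists l; apply: val_inj.
by rewrite raddf_sum /= e; apply: eq_bigr.
Qed.

End RulerAlgebra.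

Section RulerAlgebraTheory.
Variables (K : fieldType) (R : comAlgType K) (t : nat -> R).

Local Notation letter := (option bool).
Local Notation alg := (ruler_alg t).
Local Notation rword := (rword t).
Local Notation word_weight := (word_weight t).

Lemma ravalM (a b : alg) i j :
  raval (a * b) i j = \sum_(k < j.+1) raval a i k * raval b k j.
Proof. by []. Qed.

Lemma rword_mul w (a : alg) i j :
  raval (rword w * a) i j = word_weight w i * raval a (i + size w)%N j.
Proof. exact: word_mul. Qed.

Lemma raval_sum (I : Type) (s : seq I) (P : pred I) (F : I -> alg) i j :
  raval (\sum_(x <- s | P x) F x) i j = \sum_(x <- s | P x) raval (F x) i j.
Proof. by elim/big_rec2: _ => //= x y f _ <-. Qed.

Lemma ruler_alg_neq0 (a : alg) : a != 0 -> exists i d, raval a i (i + d)%N != 0.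
Proof.
move=> a0; apply: contrapT => H; move/eqP: a0; apply; apply/val_inj/utmxP => i j /=.
have [ij|ji] := leqP i j; last by rewrite utvalP.
apply: contrapT => /eqP aij; apply: H; exists i, (j - i)%N.
by rewrite subnKC.
Qed.

Lemma ruler_alg_ind (P : alg -> Prop) :
  (forall w, P (rword w)) -> P 0 -> (forall k a b, P a -> P b -> P (k *: a + b)) ->
  forall a, P a.
Proof.
move=> Pw P0 PD a; have [l ->] := ruler_algP a.
elim: l => [|x l IH]; first by rewrite big_nil.
by rewrite big_cons; apply: PD.
Qed.

(** The factor of length d at place i of the ruler word, as a word in X and
    Y. *)
Definition factor i d : seq letter := [seq erase_type (ruler k) | k <- iota i d].

Lemma size_factor i d : size (factor i d) = d.
Proof. by rewrite size_map size_iota. Qed.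

Lemma word_weight_factor i d : word_weight (factor i d) i = 1.
Proof.
elim: d i => //= d IH i; rewrite IH mulr1 /erase_type.
by case: (ruler i).
Qed.

Lemma word_weight_neq0 w i : word_weight w i != 0 ->
  [seq omap (fun=> false) c | c <- w] = factor i (size w).
Proof.
elim: w i => //= c w IH i H; have cw : letter_weight t c (ruler i) != 0.
  by apply: contra_neq H => ->; rewrite mul0r.
have ww : word_weight w i.+1 != 0 by apply: contra_neq H => ->; rewrite mulr0.
rewrite (IH _ ww) /factor; congr cons; rewrite /erase_type.
by move: cw; rewrite /letter_weight; case: c {H} => [[]|]; case: (ruler i); rewrite ?eqxx.
Qed.

Definition plain : pred (seq letter) := all (fun c => c != Some true).

Lemma plain_factor i d : plain (factor i d).
Proof. by apply/allP => c /mapP[k _ ->]; rewrite /erase_type; case: (ruler k). Qed.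

Lemma word_weight_plain w i : plain w ->
  word_weight w i = (w == factor i (size w))%:R.
Proof.
move=> pw; have [->|ne] := eqVneq w (factor i (size w)).
  by rewrite word_weight_factor.
apply: contrapT => /eqP H; have e := word_weight_neq0 H.
move/eqP: ne; apply; rewrite -{}e.
rewrite -[LHS]map_id; apply/eq_in_map => c /(allP pw).
by case: c => [[]|].
Qed.

Section Shift.
Variables (N s : nat).
Hypothesis shift : forall n, (n < N)%N -> ruler (n + s) = ruler n.

(** Entries in the columns up to N depend on the first N letters of the ruler
    word only. *)
Lemma raval_shift (a : alg) i j : (j <= N)%N -> raval a (i + s)%N (j + s)%N = raval a i j.
Proof.
move=> jN; elim/ruler_alg_ind: a => [w| |k a b Ha Hb] //=; last first.
  by rewrite Ha Hb.
rewrite addnAC eqn_add2r; case: eqP => // e; rewrite {j}e in jN.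
elim: w i jN => //= c w IH i jN; rewrite shift; last by lia.
by rewrite -addSn IH//; lia.
Qed.

End Shift.

Lemma lowest_diagonal (a : alg) : a != 0 -> exists i d, raval a i (i + d)%N != 0 /\
  forall i' d', (d' < d)%N -> raval a i' (i' + d')%N = 0.
Proof.
move=> /ruler_alg_neq0 [i [d aid]].
have [|{i d aid} d /asboolP[i aid] dmin] :=
    @ex_minnP (fun d => `[< exists i, raval a i (i + d)%N != 0 >]).
  by exists d; apply/asboolP; exists i.
exists i, d; split=> // i' d' d'd; apply: contrapT => /eqP H.
by have := dmin d'; rewrite leqNgt d'd => F; apply/notF/F/asboolP; exists i'.
Qed.

Section Domain.
Hypothesis R_domain : forall a b : R, a * b = 0 -> a = 0 \/ b = 0.

(** Let the lowest nonzero diagonals of a and b be the d-th and the e-th. Every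
    term of an entry of a w b on the diagonal d + |w| + e uses an entry of a on
    or above its d-th diagonal and one of b on or above its e-th, hence both on
    these diagonals: only one term is left. *)
Lemma connecting_word (a b : alg) : a != 0 -> b != 0 ->
  exists w, a * rword w * b != 0.
Proof.
move=> /lowest_diagonal [i [d [aid amin]]] /lowest_diagonal [k [e [bke bmin]]].
have [s sid shift] := ruler_recurrent (k + e) (i + d).
pose w := factor (i + d) (k + s - (i + d)); exists w.
have szw : size w = (k + s - (i + d))%N by rewrite size_factor.
apply/eqP => ab0; have : raval (a * rword w * b) i (k + e + s)%N = 0 by rewrite ab0.
rewrite -mulrA ravalM.
have lt : (i + d < (k + e + s).+1)%N by lia.
rewrite (bigD1 (Ordinal lt)) // big1 ?addr0 => [|j].
  rewrite -[nat_of_ord (Ordinal lt)]/(i + d)%N rword_mul szw.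
  rewrite word_weight_factor mul1r subnKC; last by lia.
  rewrite (raval_shift shift)// [X in X = _]addr0 => /R_domain H.
  by case: H => /eqP; [rewrite (negPf aid)|rewrite (negPf bke)].
rewrite rword_mul szw -val_eqE /= => jid.
have [ji|ij] := ltnP j i; first by rewrite (utvalP (raval a))// mul0r.
have [jl|jg] := ltnP j (i + d).
  have -> : nat_of_ord j = (i + (j - i))%N by lia.
  by rewrite amin ?mul0r//; lia.
have [jl|jg'] := ltnP (k + e + s) (j + (k + s - (i + d))).
  by rewrite (utvalP (raval b))// !mulr0.
rewrite [X in raval b _ X](_ : _ =
  (j + (k + s - (i + d)) + (k + e + s - (j + (k + s - (i + d)))))%N); last by lia.
by rewrite bmin ?mulr0//; lia.
Qed.

Lemma ruler_alg_prime : prime_algebra alg.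
Proof.
move=> I J [I0 ID IM] [J0 JD JM] IJ0.
have [[a Ia a0]|nI] := pselect (exists2 a, I a & a != 0); last first.
  left; apply/seteqP; split=> [x Ix|x ->]//=; apply: contrapT => /eqP x0.
  by apply: nI; exists x.
have [[b Jb b0]|nJ] := pselect (exists2 a, J a & a != 0); last first.
  right; apply/seteqP; split=> [x Ix|x ->]//=; apply: contrapT => /eqP x0.
  by apply: nJ; exists x.
have [w /eqP] := connecting_word a0 b0; case.
have : ideal_mul I J (a * rword w * b) by apply: ideal_mulP => //; case: (IM (rword w) a Ia).
by rewrite IJ0.
Qed.

End Domain.

Definition ruler_gens : seq alg :=
  [:: rword [:: None]; rword [:: Some false]; rword [:: Some true]].

Lemma ruler_gensP c : rword [:: c] \in ruler_gens.
Proof. by case: c => [[]|]; rewrite !inE eqxx ?orbT. Qed.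

Lemma ruler_alg_generated (B : set alg) : GRing.subalg_closed [in B] ->
  (forall c, B (rword [:: c])) -> forall a, B a.
Proof.
move=> [B1 BL BM] Bc; have {B1 BL BM}[B1 BL BM] : [/\ B 1,
     forall k a b, B a -> B b -> B (k *: a + b)
   & forall a b, B a -> B b -> B (a * b)].
  by split=> [|k a b Ba Bb|a b Ba Bb]; apply: set_mem; rewrite ?B1 ?BL ?BM//; exact: mem_set.
apply: ruler_alg_ind => //; last by have := BL (-1) 1 1 B1 B1; rewrite scaleN1r addNr.
elim=> [|c w IH]; first by rewrite rword_nil.
by rewrite -cat1s rword_cat; exact: BM.
Qed.

Lemma ruler_alg_fg : finitely_generated alg.
Proof.
exists ruler_gens; apply/seteqP; split=> // a _ B [subB gB].
by apply: ruler_alg_generated => // c; apply: gB; exact: ruler_gensP.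
Qed.

Definition homogeneous d : set alg :=
  [set a | forall i j, j != (i + d)%N -> raval a i j = 0].

Lemma homogeneous_rword w : homogeneous (size w) (rword w).
Proof. by move=> i j /negPf ne; rewrite /= ne. Qed.

Lemma homogeneousL d k (a b : alg) :
  homogeneous d a -> homogeneous d b -> homogeneous d (k *: a + b).
Proof. by move=> Ha Hb i j ij /=; rewrite Ha// Hb// scaler0 addr0. Qed.

Lemma ruler_alg_grading : grading homogeneous.
Proof.
split.
- move=> n; split=> [|k a b]; first by apply/mem_set => i j _.
  by move=> /set_mem Ha /set_mem Hb; apply/mem_set/homogeneousL.
- move=> n m x y Hx Hy i j jinm; rewrite ravalM big1// => k _.
  have [e|ne] := eqVneq (nat_of_ord k) (i + n)%N; last by rewrite Hx// mul0r.
  by rewrite Hy ?mulr0// e -addnA.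
- move=> x; have [l ->] := ruler_algP x.
  pose N := (\max_(c <- l) (size c.2).+1)%N.
  exists N, (fun d => \sum_(c <- l | size c.2 == d) c.1 *: rword c.2); split.
    move=> d; elim/big_rec: _ => [//|c y /eqP <- Hy].
    by apply: homogeneousL => //; exact: homogeneous_rword.
  rewrite (exchange_big_dep xpredT)//= [LHS]big_seq [RHS]big_seq; apply: eq_bigr => c cl.
  have lt : (size c.2 < N)%N by rewrite /N; exact: (leq_bigmax_seq c).
  by rewrite (big_pred1 (Ordinal lt))// => d; rewrite /= -val_eqE eq_sym.
- move=> n f Hf f0 i ltin; apply/val_inj/utmxP => p q.
  have [->|ne] := eqVneq q (p + i)%N; last exact: Hf.
  move/(congr1 (fun x : alg => raval x p (p + i)%N)): f0; rewrite raval_sum.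
  rewrite (bigD1 (Ordinal ltin))//= big1 ?addr0// => j; rewrite -val_eqE/= => ji.
  by apply: Hf; rewrite eqn_add2l eq_sym.
Qed.

End RulerAlgebraTheory.

(** * Polynomial identities *)
Section Markers.

Lemma factor_eqP L p q : factor p L = factor q L ->
  forall i, (i < L)%N -> erase_type (ruler (p + i)) = erase_type (ruler (q + i)).
Proof.
move=> e i iL; have := congr1 (fun s => nth None s i) e.
by rewrite /factor !(nth_map 0%N) ?size_iota// !nth_iota.
Qed.

(** The smaller of the two gaps ends with a letter y at a place where the other
    one still has a letter x. *)
Lemma factor_marker p q l m L : ruler p = Some l -> ruler q = Some m ->
  ((gap m).+1 < L)%N -> factor p L = factor q L -> l = m.
Proof.
move=> pl qm mL /factor_eqP e.
have [Hl [cl El]] := ruler_followed pl; have [Hm [cm Em]] := ruler_followed qm.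
have [lm|ml|/gap_inj//] := ltngtP (gap l) (gap m).
  have lL : ((gap l).+1 < L)%N by lia.
  by have := e _ lL; rewrite El Hm.
by have := e (gap m).+1; rewrite Em Hl// => /(_ mL).
Qed.

End Markers.

Section NotPI.
Variables (K : fieldType) (R : comAlgType K) (t : nat -> R).
Local Notation alg := (ruler_alg t).

(** The place of the first letter of type j + 1. Type 0 is left out because
    the first segment would be too short to contain the marker
    y x^(gap 0) y. *)
Definition segment_start j := size (block j.+1).
Definition segment_size j := (segment_start j.+1 - segment_start j)%N.

Lemma segment_startS j : (segment_start j + segment_size j = segment_start j.+1)%N.
Proof. by rewrite subnKC// size_block_mono. Qed.

Lemma segment_start_mono i j : (i < j)%N -> (segment_start i < segment_start j)%N.
Proof.
move=> ij; apply: leq_trans (size_block_mono (_ : i.+2 <= j.+1)%N) => //.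
by rewrite size_blockS /segment_start; lia.
Qed.

Lemma segment_start_inj : injective segment_start.
Proof.
by move=> i j e; case: (ltngtP i j) => // /segment_start_mono; rewrite e ltnn.
Qed.

Definition segment j : seq (option bool) := factor (segment_start j) (segment_size j).

(** A segment is long enough to determine the type of its first letter. *)
Lemma segment_weight i j : word_weight t (segment j) (segment_start i) = (j == i)%:R.
Proof.
have [->|ne] := eqVneq j i; first by rewrite word_weight_factor.
rewrite word_weight_plain ?plain_factor// size_factor; case: eqP => // e.
case/eqP: ne; apply/esym/succn_inj.
apply: factor_marker (ruler_size_block i.+1) (ruler_size_block j.+1) _ (esym e).
rewrite /segment_size /segment_start [size (block j.+2)]size_blockS.
by have := leq_size_block j.+1; lia.
Qed.

Section Substitution.
Variable m0 : seq nat.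
Let d := size m0.

(** The j-th segment plays the role of the matrix unit E_(j, j+1), and the
    variable i is sent to the sum of the units at the positions where i occurs
    in the monomial m0. *)
Definition segment_subst (i : nat) : alg :=
  \sum_(l < d | nth 0%N m0 l == i) rword t (segment l).

Lemma segment_subst_prod (s : seq nat) j : (j <= d)%N ->
  raval (\prod_(i <- s) segment_subst i) (segment_start j) (segment_start d) =
  (s == drop j m0)%:R.
Proof.
elim: s j => [|i s IH] j jd.
  rewrite big_nil [LHS]utmx1E (inj_eq segment_start_inj) eqn_leq jd /=.
  by rewrite eq_sym -size_eq0 size_drop subn_eq0.
rewrite big_cons mulr_suml raval_sum.
rewrite (eq_bigr (fun l : 'I_d => (nat_of_ord l == j)%:R *
    raval (\prod_(i <- s) segment_subst i)
      (segment_start j + segment_size l)%N (segment_start d))); last first.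
  by move=> l _; rewrite rword_mul segment_weight size_factor.
have [jlt|] := ltnP j d; last first.
  move=> dj; rewrite big1 => [|l _].
    by rewrite drop_oversize.
  by rewrite ltn_eqF ?mul0r// (leq_trans (ltn_ord l)).
rewrite (drop_nth 0%N)// eqseq_cons.
have [ji|ji] := eqVneq i (nth 0%N m0 j).
  rewrite (bigD1 (Ordinal jlt)) /=; last by rewrite ji.
  rewrite eqxx mul1r segment_startS IH// big1 ?addr0// => l /andP[_].
  by rewrite -val_eqE/= => /negPf ->; rewrite mul0r.
rewrite big1// => l /eqP li.
have /negPf -> : nat_of_ord l != j by apply: contra_neq ji => <-.
by rewrite mul0r.
Qed.

End Substitution.

(** In the row of the start of the first segment and the column of the end of the
    last one, the substitution leaves only the coefficient of the monomial m0. *)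
Lemma ruler_alg_not_PI : ~ PI_algebra alg.
Proof.
move=> [p p0]; have [m0 pm0] : exists m, monalg.mcoeff m p != 0.
  apply: contrapT => H; move/eqP: p0; apply; apply/monalg.malgP => m.
  rewrite monalg.mcoeff0; apply: contrapT => /eqP mp; apply: H; by exists m.
move=> /(_ (segment_subst m0)).
move=> /(congr1 (fun x : alg => raval x (segment_start 0) (segment_start (size m0)))).
have key c (x : alg) i j : raval (in_alg alg c * x) i j = c *: raval x i j.
  by rewrite -[in_alg alg c]/(c%:A) mulr_algl.
rewrite /monalg.mmap raval_sum (big_fsetD1 m0) -?monalg.mcoeff_neq0//.
rewrite key segment_subst_prod// drop0 eqxx big1_seq.
  by rewrite [LHS]addr0 => /eqP; rewrite scaler_eq0 (negPf pm0) oner_eq0.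
move=> m /andP[_]; rewrite in_fsetD1 => /andP[mm0 _].
by rewrite key segment_subst_prod// drop0 -monalg.fmP (negPf mm0) scaler0.
Qed.

End NotPI.

(** * Transcendence bases *)
Section TranscendenceBasis.
Variables (K : fieldType) (C : comAlgType K).

Lemma chain_finite_cover (F : set (set C)) (B0 : set C) n (x : 'I_n -> C) :
  total_on F subset -> (forall i, (\bigcup_(X in F) X `|` B0) (x i)) ->
  exists2 X : set C, F X \/ X = set0 & forall i, (X `|` B0) (x i).
Proof.
move=> Ftot xF; suff /(_ n) [X FX HX] : forall m, exists2 X : set C, F X \/ X = set0 &
    forall i : 'I_n, (i < m)%N -> (X `|` B0) (x i).
  by exists X => // i; exact: HX.
elim=> [|m [X FX HX]]; first by exists set0; [right|].
have [mn|nm] := ltnP m n; last first.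
  by exists X => // i _; apply: HX; exact: leq_trans nm.
have step Z : X `<=` Z -> (Z `|` B0) (x (Ordinal mn)) ->
    forall i : 'I_n, (i < m.+1)%N -> (Z `|` B0) (x i).
  move=> XZ Zm i; rewrite ltnS leq_eqVlt => /orP[/eqP im|/HX[/XZ|]]; [|by left|by right].
  by rewrite (_ : i = Ordinal mn)//; exact: val_inj.
have [[Y FY Ym]|B0m] := xF (Ordinal mn); last first.
  by exists X => //; apply: step => //; right.
case: FX => [FX|X0]; last first.
  by exists Y; [left|apply: step => //; [rewrite X0|left]].
have [XY|YX] := Ftot X Y FX FY; first by exists Y; [left|apply: step => //; left].
by exists X; [left|apply: step => //; left; exact: YX].
Qed.

(** The sets whose union with B0 is independent, rather than the independent
    sets that contain B0, are closed under unions of arbitrary chains: this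
    includes the empty chain. *)
Lemma transcendence_basis_extend (B0 : set C) : alg_independent B0 ->
  exists2 B, transcendence_basis B & B0 `<=` B.
Proof.
move=> B0i; pose P := [set X : set C | alg_independent (X `|` B0)].
have [|A [PA Amax]] := @Zorn_bigcup _ P.
  move=> F FP Ftot n x xinj xF; have [X FX HX] := chain_finite_cover Ftot xF.
  apply: (_ : alg_independent (X `|` B0)) HX => //.
  by case: FX => [/FP//|->]; rewrite set0U.
exists (A `|` B0); last exact: subsetUr.
split=> // B' B'i AB'; have AB := subset_trans (@subsetUl _ A B0) AB'.
have BE : B' `|` B0 = B' by apply/setUidPl; exact: subset_trans (@subsetUr _ A B0) AB'.
have B'A : B' `<=` A.
  apply: contrapT => H; apply: (Amax B'); first by split.
  by rewrite /P /= BE.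
by apply/seteqP; split => // z /B'A; left.
Qed.

End TranscendenceBasis.

(** * The extended centre *)
Section CentralMultipliers.
Variables (K : fieldType) (R : comAlgType K) (t : nat -> R).
Local Notation alg := (ruler_alg t).
Hypothesis R_domain : forall a b : R, a * b = 0 -> a = 0 \/ b = 0.

(** The elements of the algebra whose multiple by r stays in the algebra. It is
    an ideal because multiplication by r commutes with all matrices; what
    remains to be shown for a given r is that it is nonzero. *)
Definition denominators (r : R) : set alg :=
  [set a | utmx_rscale r (raval a) \in word_span t].

Definition multiplier (r : R) (a : alg) : alg := insubd 0 (utmx_rscale r (raval a)).

Lemma multiplierE r a : denominators r a ->
  raval (multiplier r a) = utmx_rscale r (raval a).
Proof. by move=> ra; rewrite /multiplier [LHS]val_insubd ra. Qed.

Lemma denominators_ideal r : ideal (denominators r).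
Proof.
have [_ spanL spanM] := word_span_subalg_closed t.
split=> [|a b Ha Hb|u a Ha].
- rewrite /denominators /= (_ : utmx_rscale _ _ = 0); first exact: (ravalP (0 : alg)).
  by apply: utmxP => i j /=; rewrite mulr0.
- suff : utmx_rscale r (raval a + raval b) \in word_span t by [].
  by rewrite utmx_rscaleD -[X in X + _]scale1r spanL.
- suff : utmx_rscale r (raval u * raval a) \in word_span t /\
         utmx_rscale r (raval a * raval u) \in word_span t by [].
  by rewrite utmx_rscaleMr utmx_rscaleMl; split; apply: spanM => //; exact: ravalP.
Qed.

Lemma multiplier_right_hom r : right_hom (denominators r) (multiplier r).
Proof.
have [_ ID IM] := denominators_ideal r.
split=> [a b Ha Hb|a b Ha]; apply: val_inj; rewrite /= multiplierE ?multiplierE//.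
- by rewrite utmx_rscaleD.
- exact: ID.
- by rewrite -utmx_rscaleMl.
- by case: (IM b a Ha).
Qed.

Lemma multiplierMr r u a : denominators r a ->
  multiplier r (u * a) = u * multiplier r a.
Proof.
move=> Ha; have [_ _ IM] := denominators_ideal r.
apply: val_inj; rewrite /= !multiplierE//; first by rewrite -utmx_rscaleMr.
by case: (IM u a Ha).
Qed.

Variable primeA : prime_algebra alg.
Local Notation mart := (martindale primeA).

(** An element of the Martindale ring acts as r if some representative is
    multiplication by r on a nonzero ideal. This relation is compatible with
    the ring operations, and it replaces a computation of polynomials in the
    Martindale ring by one in R. *)
Definition acts_as (z : mart) (r : R) : Prop :=
  exists2 p : qpair alg, z = \pi_mart p & exists L : set alg,
    [/\ nonzero_ideal L, L `<=` qdom p &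
        forall x, L x -> raval (qfun p x) = utmx_rscale r (raval x)].

Lemma acts_asD z z' r r' : acts_as z r -> acts_as z' r' -> acts_as (z + z') (r + r').
Proof.
move=> [p -> [L [L0 Lp HL]]] [p' -> [L' [L'0 Lp' HL']]].
exists (qadd primeA p p'); first by rewrite piD.
exists (L `&` L'); split; first exact: nonzero_idealI.
  by move=> x [/Lp ? /Lp' ?].
move=> x [Lx L'x] /=; rewrite HL// HL'//.
by apply: utmxP => i j /=; rewrite mulrDl.
Qed.

Lemma acts_asM z z' r r' : acts_as z r -> acts_as z' r' -> acts_as (z * z') (r * r').
Proof.
move=> [p -> [L [L0 Lp HL]]] [p' -> [L' [L'0 Lp' HL']]].
exists (qmul primeA p p'); first by rewrite piM.
exists (ideal_mul L' L); split; first exact: nonzero_ideal_mul.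
  exact: ideal_mulS.
move=> x Hx /=; rewrite HL.
  rewrite HL'; last exact: (ideal_mul_subl L'0.1 Hx).
  by apply: utmxP => i j /=; rewrite mulrA.
exact: (right_hom_comp L0.1 L'0.1 (right_homS Lp (qfunP p))
                      (right_homS Lp' (qfunP p'))).2.
Qed.

Lemma acts_asZ z r k : acts_as z r -> acts_as (k *: z) (k *: r).
Proof.
move=> [p -> [L [L0 Lp HL]]]; exists (qscale k p); first by rewrite piZ.
exists L; split=> // x Lx /=; rewrite HL//.
by apply: utmxP => i j /=; rewrite scalerAl.
Qed.

Lemma acts_as1 : acts_as 1 1.
Proof.
exists (qconst alg 1) => //; exists setT; split => //; first exact: nonzero_idealT.
move=> x _ /=; apply: utmxP => i j /=.
by rewrite scale1r mul1r.
Qed.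

(** A nonzero r cannot annihilate a nonzero ideal, as R is a domain. *)
Lemma acts_as_eq0 r : acts_as 0 r -> r = 0.
Proof.
move=> [p /esym/martindale_eqP [M [M0 sM eM]] [L [L0 Lp HL]]].
have [_ [x [Lx Mx] x0]] := nonzero_idealI primeA L0 M0.
have [i [d xid]] := ruler_alg_neq0 x0.
have : raval (qfun p x) i (i + d)%N = 0 by rewrite eM//= scale0r.
rewrite HL//= => /R_domain; case=> // /eqP.
by rewrite (negPf xid).
Qed.

Lemma acts_as_inj z r s : acts_as z r -> acts_as z s -> r = s.
Proof.
move=> zr /(acts_asZ (-1)) zs; have := acts_asD zr zs.
by rewrite !scaleN1r subrr => /acts_as_eq0/eqP; rewrite subr_eq0 => /eqP.
Qed.

Section Central.
Variable r : R.
Hypothesis denom_neq0 : nonzero_ideal (denominators r).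

Definition multiplier_qpair : qpair alg :=
  QPair denom_neq0 (multiplier_right_hom r).

(** Let q be a right module homomorphism on an ideal J. On a product u v with u
    in J and v a denominator of r, both compositions give q(u) (r v). *)
Lemma multiplier_central : \pi_mart multiplier_qpair \in @centre _ _ primeA.
Proof.
apply/centreP; elim/martindaleW => q; rewrite !piM.
pose J := qdom q; have J0 : nonzero_ideal J := qdomP q.
apply: qequivI; first exact: (nonzero_idealI primeA
  (nonzero_ideal_mul primeA J0 denom_neq0) (nonzero_ideal_mul primeA denom_neq0 J0)).
- by move=> x [].
- by move=> x [].
move=> x [Hx _] /=.
have [D0 DD DM] := denom_neq0.1; have [JJ0 JD JM] := J0.1.
have [qD qM] := qfunP q; have [mD mM] := multiplier_right_hom r.
suff [] : [/\ J x, denominators r x, denominators r (qfun q x), J (multiplier r x)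
    & multiplier r (qfun q x) = qfun q (multiplier r x)] by [].
move: x Hx; apply: ideal_mul_min.
- rewrite (right_hom0 J0.1 (qfunP q)) (right_hom0 denom_neq0.1 (multiplier_right_hom r)).
  by rewrite (right_hom0 J0.1 (qfunP q)); split.
- move=> x y [Jx Dx Dqx Jmx ex] [Jy Dy Dqy Jmy ey].
  rewrite qD// mD// mD// qD// ex ey; split=> //; [exact: JD|exact: DD|exact: DD|exact: JD].
- move=> u v Ju Dv; have [Duv _] := DM u v Dv; have [_ Juv] := JM v u Ju.
  have [_ Jm] := JM (multiplier r v) u Ju; have [Dq _] := DM (qfun q u) v Dv.
  by rewrite qM// multiplierMr// multiplierMr// qM//; split.
Qed.

Definition central_multiplier : extended_centre primeA :=
  ExtendedCentre multiplier_central.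

Lemma acts_as_central_multiplier : acts_as (ecval central_multiplier) r.
Proof.
exists multiplier_qpair => //; exists (denominators r); split=> // x Dx /=.
exact: multiplierE.
Qed.

End Central.

Section Marker.
Variable k : nat.

Definition marker_tail : seq (option bool) := factor (size (block k)).+1 (gap k).+1.

Lemma factor_size_block : factor (size (block k)) (gap k).+2 = Some false :: marker_tail.
Proof. by rewrite /factor /= ruler_size_block. Qed.

(** Both words occur only at places of type k, where the letters Y and Z differ
    by the factor t k. *)
Lemma marker_scale :
  utmx_rscale (t k) (raval (rword t (Some false :: marker_tail))) =
  raval (rword t (Some true :: marker_tail)).
Proof.
move: marker_tail factor_size_block => v vE.
apply: utmxP => i j /=; case: ifP => _; last by rewrite mulr0.
case ri: (ruler i) => [l|]; last by rewrite !mul0r mulr0.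
have [->|ne] := eqVneq (word_weight t v i.+1) 0; first by rewrite !mulr0.
rewrite mul1r; congr (t _ * _); apply/esym.
have wne : word_weight t (factor (size (block k)) (gap k).+2) i != 0.
  by rewrite vE /= ri mul1r.
move: wne; rewrite word_weight_plain ?plain_factor// size_factor.
have [e _|_] := eqVneq (factor (size (block k)) (gap k).+2) (factor i (gap k).+2).
  exact: factor_marker ri (ruler_size_block k) _ (esym e).
by rewrite eqxx.
Qed.

Lemma denominators_indet : nonzero_ideal (denominators (t k)).
Proof.
split; first exact: denominators_ideal.
exists (rword t (Some false :: marker_tail)).
  by rewrite /denominators /= marker_scale; exact: ravalP.
rewrite -factor_size_block; apply/eqP => e; suff /eqP : 1 = 0 :> R by rewrite oner_eq0.
rewrite -(word_weight_factor t (size (block k)) (gap k).+2) -word_diag.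
by rewrite -[word t _]/(raval (rword t _)) e.
Qed.

End Marker.

Definition central_indet k : extended_centre primeA :=
  central_multiplier (denominators_indet k).

Lemma acts_as_central_indet k : acts_as (ecval (central_indet k)) (t k).
Proof. exact: acts_as_central_multiplier. Qed.

Hypothesis t_inj : injective t.
Hypothesis t_indep : forall n (x : 'I_n -> nat), injective x ->
  forall p : mpoly.mpoly n K, mpoly.mmap (in_alg R) (t \o x) p = 0 -> p = 0.

Lemma central_indet_inj : injective central_indet.
Proof.
move=> k l e; apply: t_inj.
by apply: acts_as_inj (acts_as_central_indet k) _; rewrite e; exact: acts_as_central_indet.
Qed.

Lemma acts_as_mmap n (z : 'I_n -> extended_centre primeA) (r : 'I_n -> R) p :
  (forall i, acts_as (ecval (z i)) (r i)) ->
  acts_as (ecval (mpoly.mmap (in_alg _) z p)) (mpoly.mmap (in_alg R) r p).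
Proof.
move=> zr; rewrite /mpoly.mmap.
elim/big_rec2: _ => [|m a b _ Hab].
  have := acts_asZ 0 acts_as1; by rewrite !scale0r.
apply: acts_asD => //; apply: acts_asM; first exact: acts_asZ acts_as1.
rewrite /mpoly.mmap1; elim/big_rec2: _ => [|i a' b' _ Hab']; first exact: acts_as1.
apply: acts_asM => //; elim: (m i) => [|e IH]; first exact: acts_as1.
by rewrite !exprS; apply: acts_asM; [exact: zr|exact: IH].
Qed.

Lemma central_indet_alg_independent : alg_independent (range central_indet).
Proof.
move=> n z zinj zr p zp.
have /choice [x Hx] : forall i, exists k, central_indet k = z i.
  by move=> i; have [k _ e] := zr i; exists k.
have xinj : injective x by move=> i j e; apply: zinj; rewrite -!Hx e.
apply: (t_indep xinj); apply: acts_as_eq0.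
have := @acts_as_mmap n z (t \o x) p; rewrite zp; apply => i.
by rewrite -Hx; exact: acts_as_central_indet.
Qed.

Lemma infinite_trdeg_extended_centre : infinite_trdeg (extended_centre primeA).
Proof.
have [B Bt sB] := transcendence_basis_extend central_indet_alg_independent.
exists B => //; apply: sub_infinite_set sB _; apply/infiniteP.
by have /card_eqPle[] := inj_card_eq (A := setT) (in2W central_indet_inj).
Qed.

End CentralMultipliers.

(** * Dimension *)
Section Dimension.
Variables (K : fieldType) (A : algType K).
Implicit Types (S U : set A) (s u : seq A).

Lemma kspan_min S U : GRing.submod_closed [in U] -> S `<=` U -> kspan S `<=` U.
Proof. by move=> subU SU x; apply. Qed.

Lemma sub_kspan S : S `<=` kspan S.
Proof. by move=> x Sx U [_ /(_ x Sx)]. Qed.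

Lemma kspan_submod S : GRing.submod_closed [in kspan S].
Proof.
split=> [|k a b /set_mem Ha /set_mem Hb]; apply/mem_set => U [subU SU].
  exact: set_mem subU.1.
by apply: set_mem; apply: subU.2; apply: mem_set; [apply: Ha|apply: Hb].
Qed.

Lemma submodL U k a b : GRing.submod_closed [in U] -> U a -> U b -> U (k *: a + b).
Proof. by move=> [_ UL] Ua Ub; apply: set_mem; apply: UL; exact: mem_set. Qed.

Lemma submod_sum U (I : finType) (c : I -> K) (f : I -> A) :
  GRing.submod_closed [in U] -> (forall i, U (f i)) -> U (\sum_i c i *: f i).
Proof.
move=> subU Uf; elim/big_rec: _ => [|i x _ Ux]; first exact: set_mem subU.1.
exact: submodL.
Qed.

Lemma kspan_seqP s x : kspan [set` s] x <->
  exists c : 'I_(size s) -> K, x = \sum_i c i *: s`_i.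
Proof.
split; last first.
  move=> [c ->]; apply: submod_sum; first exact: kspan_submod.
  by move=> i; apply: sub_kspan; rewrite /= mem_nth.
apply: (@kspan_min _ [set x | exists c : 'I_(size s) -> K, x = \sum_i c i *: s`_i])
  => [|{}x /= xs].
  split=> [|k a b /set_mem[c ->] /set_mem[c' ->]]; apply/mem_set.
    by exists (fun=> 0); rewrite big1// => i _; rewrite scale0r.
  exists (fun i => k * c i + c' i); rewrite scaler_sumr -big_split /=.
  by apply: eq_bigr => i _; rewrite scalerDl scalerA.
have lt : (index x s < size s)%N by rewrite index_mem.
exists (fun i => (i == Ordinal lt)%:R); rewrite (bigD1 (Ordinal lt))//= eqxx scale1r.
by rewrite nth_index// big1 ?addr0// => i /negPf ->; rewrite scale0r.
Qed.

(** The matrix of coefficients of s in terms of u has a trivial left kernel, so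
    it has at least as many columns as rows. *)
Lemma lin_indep_size_le s u : lin_indep s -> (forall x, x \in s -> kspan [set` u] x) ->
  (size s <= size u)%N.
Proof.
move=> si su; have /choice [M HM] : forall i : 'I_(size s), exists c : 'I_(size u) -> K,
    s`_i = \sum_j c j *: u`_j.
  by move=> i; apply/kspan_seqP; apply: su; exact: mem_nth.
pose B : 'M[K]_(size s, size u) := \matrix_(i, j) M i j.
have : row_free B.
  rewrite -kermx_eq0; apply/rowV0P => v /sub_kermxP vB.
  apply/rowP => i; rewrite mxE; apply: si (fun i => v 0 i) _ i.
  transitivity (\sum_j (v *m B) 0 j *: u`_j); last first.
    by rewrite vB big1// => j _; rewrite mxE scale0r.
  under eq_bigr => i _ do rewrite HM scaler_sumr.
  rewrite exchange_big; apply: eq_bigr => j _ /=.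
  by rewrite mxE scaler_suml; apply: eq_bigr => i _; rewrite mxE scalerA.
by rewrite /row_free => /eqP {1}<-; exact: rank_leq_col.
Qed.

Lemma lin_indep_cons x s : lin_indep s -> ~ kspan [set` s] x -> lin_indep (x :: s).
Proof.
move=> si xs c; rewrite /= big_ord_recl /= => e.
have c0 : c ord0 = 0.
  apply: contrapT => /eqP c0; apply: xs; apply/kspan_seqP.
  exists (fun i => - (c ord0)^-1 * c (lift ord0 i)).
  under eq_bigr => i _ do rewrite -scalerA.
  rewrite -scaler_sumr; apply: (scalerI c0); rewrite scalerA mulrN mulfV// scaleN1r.
  by apply/eqP; rewrite -addr_eq0; apply/eqP.
move: e; rewrite c0 scale0r add0r => /si ci i.
by case: (unliftP ord0 i) => [j|] ->.
Qed.

(** An independent family in U has at most size u members; one with the largest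
    possible number of members is a basis. *)
Lemma basis_exists U u : GRing.submod_closed [in U] -> U `<=` kspan [set` u] ->
  exists s, is_basis U s.
Proof.
move=> subU Uu.
pose P n := `[< exists s, [/\ lin_indep s, (forall x, x \in s -> U x) & size s = n] >].
have [||n /asboolP[s [si sU sn]] nmax] := @ex_maxnP P (size u).
- by exists 0%N; apply/asboolP; exists [::]; split=> // c _ [].
- by move=> n /asboolP[s [si sU <-]]; apply: lin_indep_size_le => // x /sU /Uu.
exists s; split=> //; apply/seteqP; split; first exact: kspan_min.
move=> x Ux; apply: contrapT => xs.
have /nmax : P (size s).+1; last by rewrite sn ltnn.
apply/asboolP; exists (x :: s); split=> //; first exact: lin_indep_cons.
by move=> y; rewrite inE => /orP[/eqP->|/sU].
Qed.

(** This holds for every set U: kdim is 0 when U has no finite basis. *)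
Lemma kdim_le U u : U `<=` kspan [set` u] -> (kdim U <= size u)%N.
Proof.
move=> Uu; rewrite /kdim; case: xgetP => [s _ [si sU]|//].
by apply: lin_indep_size_le => // x xs; apply: Uu; rewrite -sU; exact: sub_kspan.
Qed.

Lemma kdim_ge U u s : GRing.submod_closed [in U] -> U `<=` kspan [set` u] ->
  lin_indep s -> (forall x, x \in s -> U x) -> (size s <= kdim U)%N.
Proof.
move=> subU Uu si sU; have [b bb] := basis_exists subU Uu.
rewrite /kdim; case: xgetP => [b' _ [_ b'U]|/(_ b)//].
by apply: lin_indep_size_le => // x /sU; rewrite b'U.
Qed.

End Dimension.

(** * Growth *)
Section Growth.
Variables (K : fieldType) (R : comAlgType K) (t : nat -> R).
Local Notation alg := (ruler_alg t).
Local Notation letter := (option bool).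

Definition gens_frame : set alg := kspan [set` 1 :: ruler_gens t].

Lemma gens_frame_letter c : gens_frame (rword t [:: c]).
Proof. by apply: sub_kspan; rewrite /= inE ruler_gensP orbT. Qed.

Lemma gens_frame1 : gens_frame 1.
Proof. by apply: sub_kspan; rewrite /= inE eqxx. Qed.

Lemma frame_gens_frame : frame gens_frame.
Proof.
split; [by eexists|exact: gens_frame1|].
apply/seteqP; split=> // a _ B [subB gB].
by apply: ruler_alg_generated => // c; apply: gB; exact: gens_frame_letter.
Qed.

Definition short_words n : set alg :=
  kspan [set x | exists2 w, (size w <= n)%N & x = rword t w].

Lemma short_words_mul m n x y : short_words m x -> short_words n y ->
  short_words (m + n) (x * y).
Proof.
move=> Hx; move: y.
have sub := kspan_submod [set x : alg | exists2 w, (size w <= m + n)%N & x = rword t w].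
apply: (@kspan_min _ _ _ [set y : alg | short_words (m + n) (x * y)]).
  split=> [|k a b /set_mem Ha /set_mem Hb]; apply/mem_set => /=.
    by rewrite mulr0; exact: set_mem sub.1.
  by rewrite mulrDr -scalerAr; exact: submodL sub Ha Hb.
move=> _ [w wn ->] /=; move: x Hx.
apply: (@kspan_min _ _ _ [set x : alg | short_words (m + n) (x * rword t w)]).
  split=> [|k a b /set_mem Ha /set_mem Hb]; apply/mem_set => /=.
    by rewrite mul0r; exact: set_mem sub.1.
  by rewrite mulrDl -scalerAl; exact: submodL sub Ha Hb.
move=> _ [v vm ->] /=; apply: sub_kspan; exists (v ++ w); last by rewrite rword_cat.
by rewrite size_cat leq_add.
Qed.

Lemma subspace_pow_short n : subspace_pow gens_frame n `<=` short_words n.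
Proof.
apply: kspan_min; first exact: kspan_submod.
move=> _ [v Hv ->]; elim: n v Hv => [|n IH] v Hv.
  by rewrite big_ord0; apply: sub_kspan; exists [::]; rewrite ?rword_nil.
rewrite big_ord_recl; apply: (@short_words_mul 1 n); last by apply: IH => i.
apply: kspan_min (Hv ord0); first exact: kspan_submod.
move=> x /=; rewrite inE => /orP[/eqP->|].
  by apply: sub_kspan; exists [::]; rewrite ?rword_nil.
rewrite !inE => /or3P[] /eqP ->; apply: sub_kspan.
- by exists [:: None].
- by exists [:: Some false].
- by exists [:: Some true].
Qed.

Lemma subspace_pow_rword n w : (size w <= n)%N -> subspace_pow gens_frame n (rword t w).
Proof.
move=> wn; apply: sub_kspan => /=.
elim: n w wn => [|n IH] w.
  rewrite leqn0 size_eq0 => /eqP ->; exists (fun=> 1); first by case.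
  by rewrite big_ord0 rword_nil.
have ext c v : gens_frame c ->
    (exists2 f : 'I_n -> alg, (forall i, gens_frame (f i)) & v = \prod_(i < n) f i) ->
    exists2 f : 'I_n.+1 -> alg, (forall i, gens_frame (f i)) & c * v = \prod_(i < n.+1) f i.
  move=> Hc [f Hf ->]; exists (fun i => if unlift ord0 i is Some j then f j else c).
    by move=> i; case: unlift.
  rewrite big_ord_recl unlift_none; congr (_ * _).
  by apply: eq_bigr => i _; rewrite liftK.
case: w => [|c w] wn.
  by rewrite -[rword t _]mul1r; apply: ext; [exact: gens_frame1|exact: IH].
by rewrite -cat1s rword_cat; apply: ext; [exact: gens_frame_letter|exact: IH].
Qed.

Section UpperBound.

(** All ways to read each letter y of a word as Y or Z. *)
Fixpoint decorations (s : seq letter) : seq (seq letter) :=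
  match s with
  | [::] => [:: [::]]
  | None :: s' => map (cons None) (decorations s')
  | Some _ :: s' => map (cons (Some false)) (decorations s') ++
                    map (cons (Some true)) (decorations s')
  end.

Lemma size_decorations s : size (decorations s) = (2 ^ count isSome s)%N.
Proof.
elim: s => //= -[b|] s IH /=; last by rewrite size_map IH add0n.
by rewrite size_cat !size_map IH expnS mul2n addnn.
Qed.

Lemma mem_decorations w : w \in decorations [seq omap (fun=> false) c | c <- w].
Proof.
elim: w => //= -[[]|] w IH /=; rewrite ?mem_cat map_f ?orbT//.
Qed.

Definition window (s : seq (option nat)) q d : seq letter :=
  [seq erase_type (nth None s (q + i)) | i <- iota 0 d].

Lemma count_window s q d : (count isSome (window s q d) <= count isSome s)%N.
Proof.
elim: s q d => [|o s IH] q d.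
  rewrite leqn0 -leqn0 leqNgt -has_count; apply/hasP => -[c /mapP[i _ ->]].
  by rewrite nth_nil.
case: q => [|q]; last by apply: leq_trans (IH q d) _; rewrite /= leq_addl.
case: d => // d; rewrite /window /= -add1n iotaDl -map_comp.
by apply: leq_add; [case: o|exact: (IH 0%N d)].
Qed.

Lemma size_flatten_le (T U : Type) (f : T -> seq U) (s : seq T) D :
  (forall x, size (f x) <= D)%N -> (size (flatten (map f s)) <= size s * D)%N.
Proof.
move=> fD; elim: s => //= x s IH.
by rewrite size_cat mulSn leq_add.
Qed.

(** A finite list that contains all words of length at most n whose matrix is
    nonzero, provided that n <= gap k; see mem_candidate_words. *)
Definition candidate_words n k : seq (seq letter) :=
  flatten [seq decorations (window (padded_block n k 0) x.1 x.2) |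
    x <- [seq (q, d) | q <- iota 0 (n + size (block k) + 2), d <- iota 0 n.+1]].

Lemma size_candidate_words n k :
  (size (candidate_words n k) <= (n + size (block k) + 2) * n.+1 * 2 ^ (2 ^ k))%N.
Proof.
have D x : (size (decorations (window (padded_block n k 0) x.1 x.2)) <= 2 ^ (2 ^ k))%N.
  rewrite size_decorations leq_exp2l//; apply: leq_trans (count_window _ _ _) _.
  rewrite count_cat count_nseq -cats1 count_cat /= -count_block; lia.
by apply: leq_trans (size_flatten_le _ D) _; rewrite size_allpairs !size_iota.
Qed.

Lemma mem_candidate_words n k w : (n <= gap k)%N -> (size w <= n)%N ->
  rword t w != 0 -> w \in candidate_words n k.
Proof.
move=> nk wn w0; have [p wp] : exists p, word_weight t w p != 0.
  apply: contrapT => H; move/eqP: w0; apply; apply/val_inj/utmxP => i j /=.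
  case: ifP => // _; apply: contrapT => /eqP wi; apply: H; by exists i.
have {wp}wE := word_weight_neq0 wp.
have [q qle Hq] := ruler_factor p nk.
apply/flattenP; exists (decorations (window (padded_block n k 0) q (size w))).
  apply/mapP; exists (q, size w) => //; apply/allpairsP; exists (q, size w).
  by rewrite !mem_iota /=; split=> //; lia.
have <- : [seq omap (fun=> false) c | c <- w] = window (padded_block n k 0) q (size w).
  rewrite wE /factor /window -[p in LHS]addn0 iotaDl -map_comp; apply/eq_in_map => i.
  by rewrite mem_iota => /andP[_ iw] /=; apply: Hq; lia.
exact: mem_decorations.
Qed.

Lemma subspace_pow_candidates n k : (n <= gap k)%N ->
  subspace_pow gens_frame n `<=` kspan [set` map (rword t) (candidate_words n k)].
Proof.
move=> nk; apply: subset_trans (@subspace_pow_short n) _.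
apply: kspan_min; first exact: kspan_submod.
move=> _ [w wn ->]; have [->|w0] := eqVneq (rword t w) 0.
  exact: set_mem (kspan_submod _).1.
by apply: sub_kspan => /=; apply: map_f; exact: mem_candidate_words.
Qed.

Lemma kdim_subspace_pow_le n k : (n <= gap k)%N ->
  (kdim (subspace_pow gens_frame n) <= (n + size (block k) + 2) * n.+1 * 2 ^ (2 ^ k))%N.
Proof.
move=> nk; apply: leq_trans (size_candidate_words n k).
by apply: leq_trans (kdim_le (subspace_pow_candidates nk)) _; rewrite size_map.
Qed.

End UpperBound.

(** Words of different lengths live on different diagonals, and different words
    of the same length occur at different places: each word has an entry 1
    where all the others have entry 0. *)
Lemma lin_indep_rwords (s : seq (seq letter)) : uniq s -> all plain s ->
  (forall w, w \in s -> exists p, w = factor p (size w)) -> lin_indep (map (rword t) s).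
Proof.
move=> us ps os c e i; have := ltn_ord i; rewrite [X in (_ < X)%N -> _]size_map => lti.
pose w := nth [::] s i; have ws : w \in s by exact: mem_nth.
have [p wp] := os w ws.
have := congr1 (fun a : alg => raval a p (p + size w)%N) e; rewrite /= raval_sum.
rewrite (bigD1 i)//= big1 ?addr0 => [|j ji].
  rewrite (nth_map [::])//= -/w eqxx wp word_weight_factor => /eqP.
  by rewrite scaler_eq0 oner_eq0 orbF => /eqP.
have := ltn_ord j; rewrite [X in (_ < X)%N -> _]size_map => ltj.
rewrite (nth_map [::])//= eqn_add2l; case: eqP => [sz|_]; last by rewrite scaler0.
rewrite word_weight_plain; last by apply: (allP ps); exact: mem_nth.
by rewrite -sz -wp nth_uniq// val_eqE (negPf ji) scaler0.
Qed.

End Growth.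

Lemma leq_expn2r m n e : (m <= n)%N -> (m ^ e <= n ^ e)%N.
Proof. by case: e => // e mn; rewrite leq_exp2r. Qed.

Section LowerBound.
Variables (K : fieldType) (R : comAlgType K) (t : nat -> R).
Local Notation alg := (ruler_alg t).
Local Notation letter := (option bool).

Definition block_core k : seq letter := map erase_type (rcons (block k) (Some k.+1)).

Definition padded_core k (x : nat * nat) : seq letter :=
  nseq x.1 None ++ block_core k ++ nseq x.2 None.

Lemma size_padded_core k x : size (padded_core k x) = (x.1 + size (block k) + 1 + x.2)%N.
Proof. by rewrite !size_cat !size_nseq size_map size_rcons; lia. Qed.

(** The word B_k y begins with y, so a is the position of the first y in
    x^a B_k y x^b, and b can be found from the length. *)
Lemma padded_core_inj k : injective (padded_core k).
Proof.
have block_core_head : exists s, block_core k = Some false :: s.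
  rewrite /block_core; case: (posnP k) => [->|/head_block[j]]; first by exists [::].
  by case: (block k) => // o s /= ->; eexists.
have findE x : find isSome (padded_core k x) = x.1.
  have [s sE] := block_core_head; rewrite /padded_core sE find_cat ifF; last first.
    by apply/negP => /hasP[c]; rewrite mem_nseq => /andP[_ /eqP->].
  by rewrite size_nseq addn0.
move=> x y e; have := findE y; rewrite -e findE => x1; have := congr1 size e.
rewrite !size_padded_core; case: x y x1 {e} => [a b] [a' b'] /= ->.
by move=> e; congr (_, _); lia.
Qed.

Lemma padded_core_factor k x : (x.1 <= gap k)%N -> (x.2 <= gap k)%N ->
  exists p, padded_core k x = factor p (size (padded_core k x)).
Proof.
move=> x1 x2; have [p Hp] := ruler_long_runs x1 x2; exists p.
apply: (@eq_from_nth _ None); first by rewrite size_factor.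
move=> i; rewrite size_padded_core => ix.
rewrite /factor (nth_map 0%N) ?size_iota// nth_iota// Hp//.
rewrite /padded_core /block_core !nth_cat !size_nseq size_map !nth_nseq !if_same; case: ifP => // _.
case: ifP => [lt|/negbT lt]; first by rewrite (nth_map None).
by rewrite nth_default// leqNgt.
Qed.

Lemma kdim_subspace_pow_ge k :
  ((gap k %/ 4) ^ 2 <= kdim (subspace_pow (@gens_frame K R t) (gap k)))%N.
Proof.
have [gap1 gap2] := size_block_gap k.
pose idx := [seq (a, b) | a <- iota 0 (gap k %/ 4), b <- iota 0 (gap k %/ 4)].
have idxP x : x \in idx -> (x.1 < gap k %/ 4)%N /\ (x.2 < gap k %/ 4)%N.
  by case/allpairsP => -[a b] /= [+ + ->]; rewrite !mem_iota.
have szE : size (map (rword t) (map (padded_core k) idx)) = ((gap k %/ 4) ^ 2)%N.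
  by rewrite !size_map size_allpairs !size_iota.
rewrite -szE; apply: kdim_ge.
- exact: kspan_submod.
- exact: subspace_pow_candidates (leqnn _).
- apply: lin_indep_rwords.
  + rewrite map_inj_uniq; last exact: padded_core_inj.
    by apply: allpairs_uniq; rewrite ?iota_uniq// => -[a b] [a' b'].
  + apply/allP => _ /mapP[x xi ->]; rewrite /plain !all_cat !all_nseq orbT /= orbT andbT.
    by apply/allP => c /mapP[c0 _ ->]; case: c0.
  + move=> _ /mapP[x /idxP [x1 x2] ->]; 
    have le4 := leq_div (gap k) 4; apply: padded_core_factor; apply: ltnW.
      exact: leq_trans x1 le4.
    exact: leq_trans x2 le4.
- move=> _ /mapP[_ /mapP[x /idxP [x1 x2] ->] ->]; apply: subspace_pow_rword.
  have := leq_trunc_div (gap k) 4; rewrite size_padded_core.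
  by case: x x1 x2 => a b /=; lia.
Qed.

Local Notation d n := (kdim (subspace_pow (@gens_frame K R t) n)).
Local Open Scope nat_scope.

(** If gap k < n <= gap k.+1, the number of candidate words is at most
    10 n^2 D with D = 2^(2^(k+1)), and D^e <= gap k < n as soon as
    e <= 2^(k+1). *)
Lemma kdim_upper e : exists N, forall n, N <= n -> d n ^ e <= n ^ (2 * e + 2).
Proof.
exists (gap e + 10 ^ e + 2) => n Nn.
have [k kP kmin] := @ex_minnP (fun k => n <= gap k) (ex_intro _ n (ltnW (gap_gt n))).
have ek : e < k by rewrite ltnNge; apply/negP => /gap_leq; lia.
case: k ek kP kmin => // k ek nk kmin.
have kn : gap k < n by rewrite ltnNge; apply/negP => /kmin; rewrite ltnn.
have Bk := size_blockS_le k.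
have dn : d n <= 10 * n ^ 2 * 2 ^ (2 ^ k.+1).
  apply: leq_trans (kdim_subspace_pow_le t nk) _; rewrite leq_mul2r; apply/orP; right.
  nia.
have eS : e <= 2 ^ k.+1 by apply: leq_trans (ltnW (ltn_expl k.+1 (isT : 1 < 2))); lia.
have De : (2 ^ (2 ^ k.+1)) ^ e <= n.
  rewrite -expnM; apply: leq_trans (ltnW kn); rewrite /gap leq_exp2l//.
  by rewrite -[4]/(2 * 2) expnMn leq_mul2l eS orbT.
have e10 : 10 ^ e <= n by lia.
apply: leq_trans (leq_expn2r e dn) _.
have -> : n ^ (2 * e + 2) = n * n ^ (2 * e) * n.
  by rewrite addn2 !expnSr [n * _]mulnC.
by rewrite !expnMn -expnD addnn -mul2n !leq_mul.
Qed.

(** The limit superior needs this along a sequence of n only, and n = gap k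
    is one. *)
Lemma kdim_lower e N : exists2 n, N <= n & n ^ (2 * e) <= d n ^ e * n.
Proof.
exists (gap (N + 16 ^ e)); first by apply: leq_trans (ltnW (gap_gt _)); lia.
set k := N + 16 ^ e; have H := kdim_subspace_pow_ge k.
have gE : gap k = 4 * (gap k %/ 4).
  rewrite mulnC divnK//; apply: (@dvdn_exp2l 2 2).
  by apply: leq_trans (ltn_expl k.+1 (isT : 1 < 4)).
have g16 : 16 ^ e <= gap k by apply: leq_trans (ltnW (gap_gt _)); rewrite leq_addl.
rewrite {1}gE expnM expnMn -[4 ^ 2]/16 expnMn mulnC leq_mul//.
exact: leq_expn2r.
Qed.

End LowerBound.

(** * The limit superior *)
Section Limsup.
Variable R : realType.

Lemma limn_esup_eq (u : nat -> R) (l : R) :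
  (forall e, 0 < e -> exists N, forall n, (N <= n)%N -> u n <= l + e) ->
  (forall e N, 0 < e -> exists2 n, (N <= n)%N & l - e <= u n) ->
  limn_esup (fun n => (u n)%:E) = l%:E.
Proof.
move=> ule uge; rewrite /limn_esup limf_esupE; apply/eqP; rewrite eq_le; apply/andP; split.
  apply/lee_addgt0Pr => e e0; have [N HN] := ule e e0.
  apply: (@le_trans _ _ (ereal_sup ((fun n => (u n)%:E) @` [set n | (N <= n)%N]))).
    by apply: ereal_inf_lbound; exists [set n | (N <= n)%N] => //; exists N.
  by apply: ge_ereal_sup => _ [n /= Nn <-]; rewrite -EFinD lee_fin; exact: HN.
apply: le_ereal_inf_tmp => _ [V [N _ NV] <-]; apply/lee_subgt0Pr => e e0.
have [n Nn Hn] := uge e N e0; apply: (@le_trans _ _ (u n)%:E).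
  by rewrite -EFinB lee_fin.
by apply: ereal_sup_ubound; exists n => //; exact: NV.
Qed.

(** Taking logarithms, the first family of inequalities gives
    ln (d n) / ln n <= 2 + 2/e for all large n, and the second one gives
    ln (d n) / ln n >= 2 - 1/e for infinitely many n. *)
Lemma limn_esup_ln_ratio (d : nat -> nat) :
  (forall e, exists N, forall n, (N <= n)%N -> (d n ^ e <= n ^ (2 * e + 2))%N) ->
  (forall e N, exists2 n, (N <= n)%N & (n ^ (2 * e) <= d n ^ e * n)%N) ->
  limn_esup (fun n => (ln (d n)%:R / ln n%:R)%:E) = 2%:E :> \bar R.
Proof.
move=> dle dge.
have bound e : 0 < e -> exists2 k, (0 < k)%N & 2 < e * k%:R :> R.
  move=> e0; have ke := archi_boundP (ltW (divr_gt0 (ltr0Sn R 1) e0)).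
  exists (Num.bound (2 / e)); last by rewrite mulrC -ltr_pdivrMr.
  by rewrite -(ltr0n R) (lt_trans _ ke)// divr_gt0.
apply: limn_esup_eq => [e e0|e N e0]; have [k k0 ke] := bound e e0.
  have [N HN] := dle k; exists (N + 2)%N => n Nn.
  have n0 : (0 < n)%N by lia.
  have lnn : 0 < ln (n%:R : R) by rewrite ln_gt0// ltr1n; lia.
  rewrite ler_pdivrMr//.
  have [->|d0] := posnP (d n).
    by rewrite ln0 // mulr_ge0 ?addr_ge0 ?ltW.
  have : (d n ^ k <= n ^ (2 * k + 2))%N by apply: HN; lia.
  rewrite -(ler_nat R) !natrX -ler_ln ?posrE ?exprn_gt0 ?ltr0n//.
  rewrite !lnXn ?ltr0n// -![ln _ *+ _]mulr_natl natrD natrM => H.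
  rewrite -(ler_pM2l (_ : 0 < k%:R)) ?ltr0n//; nra.
have [n Nn Hn] := dge k (N + 2)%N; exists n; first by lia.
have n0 : (0 < n)%N by lia.
have lnn : 0 < ln (n%:R : R) by rewrite ln_gt0// ltr1n; lia.
have d0 : (0 < d n)%N.
  rewrite lt0n; apply/eqP => dn0; move: Hn.
  by rewrite dn0 exp0n// mul0n leqn0 expn_eq0; case: (n) n0.
rewrite ler_pdivlMr//; move: Hn.
rewrite -(ler_nat R) natrM !natrX -ler_ln ?posrE ?mulr_gt0 ?exprn_gt0 ?ltr0n//.
rewrite lnM ?posrE ?exprn_gt0 ?ltr0n// !lnXn ?ltr0n// -![ln _ *+ _]mulr_natl natrM => H.
rewrite -(ler_pM2l (_ : 0 < k%:R)) ?ltr0n//; nra.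
Qed.

End Limsup.

Theorem theorem1p4 (R : realType) (K : fieldType) :
  exists (A : algType K) (primeA : prime_algebra A),
    [/\ finitely_generated A,
        ~ PI_algebra A,
        exists g : nat -> set A, grading g,
        has_GKdim A (2%:E : \bar R)
      & infinite_trdeg (extended_centre primeA)].
Proof.
pose S := monalg.malg (monalg.cmonom nat) K : comAlgType K.
pose t : nat -> S := @indet K.
have domS (a b : S) : a * b = 0 -> a = 0 \/ b = 0 by exact: cpoly_domain.
exists (ruler_alg t : algType K), (ruler_alg_prime domS); split.
- exact: ruler_alg_fg.
- exact: ruler_alg_not_PI.
- by exists (@homogeneous _ _ t); exact: ruler_alg_grading.
- exists (@gens_frame _ _ t); first exact: frame_gens_frame.
  by apply: limn_esup_ln_ratio; [exact: kdim_upper|exact: kdim_lower].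
- exact: (infinite_trdeg_extended_centre domS _ (@indet_inj K) (@indet_alg_independent K)).
Qed.
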